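(* Let $\mathscr H$ be a separable infinite-dimensional complex Hilbert space, let $\tau=(T_i)_{1\le i\le n}$ be an $n$-tuple of bounded operators on $\mathscr H$, let $1\le p\le\infty$ and $m\in\mathbb N$. Then \[ k_p^-(\tau\otimes I_m)=m^{1/p}\,k_p^-(\tau), \] where $\tau\otimes I_m=(T_i\otimes I_m)_{1\le i\le n}$ acts on $\mathscr H\otimes\mathbb C^m$.
   Context: $I_m$ is the identity on $\mathbb C^m$; $1/\infty=0$. For a compact operator $T$ with singular values $s_1\ge s_2\ge\dots$ (eigenvalues of $(T^*T)^{1/2}$ in decreasing order, with multiplicity), the $(p,1)$ Lorentz norm is $|T|_p^-=\sum_{j\in\mathbb N}s_j\,j^{-1+1/p}$, and $\mathscr C_p^-$ is the ideal of compact operators with $|T|_p^-<\infty$. For an $n$-tuple $\sigma=(S_i)$ one sets $|\sigma|_p^-=\max_i|S_i|_p^-$ and $\|\sigma\|=\max_i\|S_i\|$; for an operator $A$, $[\tau,A]=([T_i,A])_{1\le i\le n}$. $\mathscr R_1^+(\mathscr H)$ denotes the finite-rank operators $A$ with $0\le A\le I$. The quasicentral modulus is $k_p^-(\tau)=\liminf_{A\in\mathscr R_1^+}|[\tau,A]|_p^-$ (liminf along the natural order on $\mathscr R_1^+$); equivalently it is the infimum of all $\alpha\in[0,\infty]$ such that $\alpha=\lim_{k}|[A_k,\tau]|_p^-$ for some sequence $A_k\in\mathscr R_1^+$ with $A_k\uparrow I$. *)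

(* Defs.v *)
From HB Require Import structures.
From Stdlib Require Import ClassicalEpsilon.
From mathcomp Require Import all_boot all_order all_algebra.
From mathcomp Require Import complex.
From mathcomp Require Import boolp classical_sets functions cardinality reals ereal.
From mathcomp Require Import topology normedtype sequences exp.

Set Implicit Arguments.
Unset Strict Implicit.
Unset Printing Implicit Defensive.

Import Order.TTheory GRing.Theory Num.Theory.
Local Open Scope ring_scope.
Local Open Scope complex_scope.
Local Open Scope classical_set_scope.

Section HilbertOps.
Variable R : realType.
Local Notation C := R[i].
Variable V : lmodType C.
Variable ip : V -> V -> C.

Definition hnorm (x : V) : R := Num.sqrt (complex.Re (ip x x)).

Definition is_inner_product : Prop :=
  (forall (a : C) (x y z : V), ip (a *: x + y) z = a * ip x z + ip y z) /\
  (forall x y : V, ip y x = conjc (ip x y)) /\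
  (forall x : V, 0 <= ip x x) /\
  (forall x : V, ip x x = 0 -> x = 0).

Definition ip_complete : Prop :=
  forall u : nat -> V,
    (forall e : R, 0 < e -> exists N : nat, forall k l : nat,
        (N <= k)%N -> (N <= l)%N -> hnorm (u k - u l) < e) ->
    exists x : V, forall e : R, 0 < e -> exists N : nat, forall k : nat,
        (N <= k)%N -> hnorm (u k - x) < e.

Definition ip_separable : Prop :=
  exists d : nat -> V, forall (x : V) (e : R), 0 < e ->
    exists k : nat, hnorm (x - d k) < e.

Definition linindep (d : nat) (v : 'I_d -> V) : Prop :=
  forall c : 'I_d -> C, \sum_(i < d) c i *: v i = 0 -> forall i, c i = 0.

Definition infinite_dimensional : Prop :=
  forall d : nat, exists v : 'I_d -> V, linindep v.

Definition separable_inf_hilbert : Prop :=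
  [/\ is_inner_product, ip_complete, ip_separable & infinite_dimensional].

Definition bounded_op (T : V -> V) : Prop :=
  exists M : R, forall x : V, hnorm (T x) <= M * hnorm x.

Definition has_dim (S : set V) (d : nat) : Prop :=
  (exists v : 'I_d -> V, (forall i, S (v i)) /\ linindep v) /\
  (forall (k : nat) (w : 'I_k -> V), (forall i, S (w i)) -> linindep w -> (k <= d)%N).

(* eigenspace of (T^* T)^{1/2} for an eigenvalue lam > 0, i.e.
   { x | T^* T x = lam^2 x } written with the inner product *)
Definition abs_eigenspace (T : V -> V) (lam : R) : set V :=
  [set x | forall y : V, ip (T x) (T y) = (lam ^+ 2)%:C * ip x y].

(* s is the sequence of singular values of T: the eigenvalues of (T^*T)^{1/2}
   in decreasing order, repeated according to multiplicity (padded with 0) *)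
Definition is_singular_values (T : V -> V) (s : nat -> R) : Prop :=
  [/\ forall j, 0 <= s j,
      forall j k, (j <= k)%N -> s k <= s j &
      forall lam : R, 0 < lam -> forall d : nat,
        ([set j | s j = lam] #= `I_d)%card <-> has_dim (abs_eigenspace T lam) d].

Definition sing_vals (T : V -> V) : nat -> R :=
  epsilon (inhabits (fun _ : nat => (0 : R))) (is_singular_values T).

Definition invp (p : \bar R) : R :=
  match p with EFin r => r^-1 | _ => 0 end.

(* (p,1) Lorentz norm |T|_p^- = sum_{j>=1} s_j j^{-1+1/p} (s indexed from 0 here) *)
Definition lorentz_norm (p : \bar R) (T : V -> V) : \bar R :=
  (\sum_(0 <= j <oo) ((sing_vals T j) * powR (j.+1)%:R (invp p - 1))%:E)%E.

Definition tuple_lorentz (p : \bar R) (n : nat) (S : 'I_n -> V -> V) : \bar R :=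
  (\big[maxe/0%E]_(i < n) lorentz_norm p (S i))%E.

Definition finite_rank (A : V -> V) : Prop :=
  exists (d : nat) (v : 'I_d -> V), forall x : V,
    exists c : 'I_d -> C, A x = \sum_(i < d) c i *: v i.

Definition R1plus : set (V -> V) :=
  [set A | [/\ linear A, finite_rank A & forall x : V, 0 <= ip (A x) x <= ip x x]].

Definition op_le (A B : V -> V) : Prop :=
  forall x : V, ip (A x) x <= ip (B x) x.

Definition commut (n : nat) (T : 'I_n -> V -> V) (A : V -> V) : 'I_n -> V -> V :=
  fun i x => T i (A x) - A (T i x).

(* k_p^-(tau) = liminf_{A in R_1^+} |[tau, A]|_p^-  (liminf along the order) *)
Definition qc_modulus (p : \bar R) (n : nat) (T : 'I_n -> V -> V) : \bar R :=
  ereal_sup [set ereal_inf [set tuple_lorentz p (commut T A) | A in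
                              [set A | R1plus A /\ op_le A0 A]]
            | A0 in R1plus].

End HilbertOps.

(* H (x) C^m realized as {ffun 'I_m -> H} with the sum inner product *)
Definition tens_ip (R : realType) (V : lmodType R[i]) (ip : V -> V -> R[i]) (m : nat)
  (f g : {ffun 'I_m -> V}) : R[i] :=
  \sum_(i < m) ip (f i) (g i).

Definition tens_op (R : realType) (V : lmodType R[i]) (m : nat) (T : V -> V)
  (f : {ffun 'I_m -> V}) : {ffun 'I_m -> V} :=
  [ffun i => T (f i)].

(* Main.v *)
(* Singular values of a finite-rank adjointable operator come from a singular
   value decomposition, and Ky Fan's principle computes the weighted sums
   [sum_j w_j s_j], [w] nonincreasing, as a maximum of
   [sum_j w_j Re <T e_j, f_j>] over orthonormal families [e], [f].

   Lower bound: given [B >= A0 (x) I] on [H (x) C^m], let [A] be the mean of its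
   diagonal blocks. Testing [[tau (x) I, B]] on the families [u_l (x) eps_i],
   [v_l (x) eps_i] built from the singular vectors of [[tau, A]], with the
   weights made constant on blocks of length [m], gives
   [m^(1/p) |[tau, A]| <= |[tau (x) I, B]|].

   Upper bound: for a finite-rank [A], each singular value of [[tau, A] (x) I] is
   repeated [m] times, and a telescoping estimate gives
   [|[tau, A] (x) I| <= m^(1/p) |[tau, A]| + m ||[tau, A]||]. The operator norm is
   made small by averaging [A_1 << A_2 << ... << A_N], where each [A_(k+1)] fixes
   everything that [A_k], [tau] and [tau^*] produce: the commutators then have
   orthogonal ranges, while their Lorentz norms stay bounded on average. *)

Require Import Defs.
From HB Require Import structures.
From mathcomp Require Import all_boot all_order all_algebra.
From mathcomp Require Import complex spectral sesquilinear.
From mathcomp Require Import boolp classical_sets functions cardinality reals ereal.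
From mathcomp Require Import topology normedtype sequences exp.
From mathcomp Require Import ring lra.
Import Order.TTheory GRing.Theory Num.Theory.
Local Open Scope ring_scope.

Set Implicit Arguments.
Unset Strict Implicit.
Unset Printing Implicit Defensive.
Local Open Scope complex_scope.

Local Notation Re := complex.Re.
Local Notation Im := complex.Im.

(** * Inner product spaces *)

Section ComplexModulus.
Variable R : realType.
Implicit Types (z w : R[i]) (a : R).

Definition nsq z : R := (Re z) ^+ 2 + (Im z) ^+ 2.

Lemma nsq_ge0 z : 0 <= nsq z.
Proof. by rewrite addr_ge0 // sqr_ge0. Qed.

Lemma mulcJ_nsq z : z * conjc z = (nsq z)%:C.
Proof. by case: z => a b; rewrite /nsq; simpc; congr (_ +i* _); ring. Qed.

Lemma nsqJ z : nsq (conjc z) = nsq z.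
Proof. by case: z => a b; rewrite /nsq /= sqrrN. Qed.

Lemma conjcM z w : conjc (z * w) = conjc z * conjc w.
Proof. by rewrite rmorphM. Qed.

Lemma ReD z w : Re (z + w) = Re z + Re w.
Proof. by case: z => ? ?; case: w. Qed.

Lemma ReN z : Re (- z) = - Re z.
Proof. by case: z. Qed.

Lemma ReJ z : Re (conjc z) = Re z.
Proof. by case: z. Qed.

Lemma ReZ a z : Re (a%:C * z) = a * Re z.
Proof. by case: z => ? ?; rewrite /= mul0r subr0. Qed.

Lemma Re_sum (I : Type) (r : seq I) (P : pred I) (F : I -> R[i]) :
  Re (\sum_(i <- r | P i) F i) = \sum_(i <- r | P i) Re (F i).
Proof. exact: (big_morph (@complex.Re R) ReD (erefl _)). Qed.

Lemma Re_mul_le z w : Re (z * w) <= (nsq z + nsq w) / 2.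
Proof.
case: z w => [a b] [c d]; rewrite /nsq /=.
by have := sqr_ge0 (a - c); have := sqr_ge0 (b + d); nra.
Qed.

End ComplexModulus.

(** * Linear maps given as plain functions *)

Section LinearMaps.
Variables (K : pzRingType) (V W : lmodType K) (A : V -> W).
Hypothesis A_lin : linear A.

Lemma linear_add x y : A (x + y) = A x + A y.
Proof. by have := A_lin 1 x y; rewrite !scale1r. Qed.

Lemma linear_zero : A 0 = 0.
Proof. by apply: (addrI (A 0)); rewrite -linear_add !addr0. Qed.

Lemma linear_scale a x : A (a *: x) = a *: A x.
Proof. by have := A_lin a x 0; rewrite linear_zero !addr0. Qed.

Lemma linear_opp x : A (- x) = - A x.
Proof. by rewrite -scaleN1r linear_scale scaleN1r. Qed.

Lemma linear_sub x y : A (x - y) = A x - A y.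
Proof. by rewrite linear_add linear_opp. Qed.

Lemma linear_big (I : Type) (r : seq I) (P : pred I) (F : I -> V) :
  A (\sum_(i <- r | P i) F i) = \sum_(i <- r | P i) A (F i).
Proof. exact: (big_morph A linear_add linear_zero). Qed.

End LinearMaps.

Section InnerProduct.
Variables (R : realType) (V : lmodType R[i]) (ip : V -> V -> R[i]).
Hypothesis ipP : is_inner_product ip.
Implicit Types (x y z : V) (A B T : V -> V).

Lemma ipDl x y z : ip (x + y) z = ip x z + ip y z.
Proof. by have [/(_ 1 x y z)] := ipP; rewrite scale1r mul1r. Qed.

Lemma ip0l z : ip 0 z = 0.
Proof. by apply: (addrI (ip 0 z)); rewrite -ipDl !addr0. Qed.

Lemma ipZl a x z : ip (a *: x) z = a * ip x z.
Proof. by have [/(_ a x 0 z)] := ipP; rewrite ip0l !addr0. Qed.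

Lemma ipC x y : ip y x = conjc (ip x y).
Proof. by case: ipP => _ []. Qed.

Lemma ipDr x y z : ip z (x + y) = ip z x + ip z y.
Proof. by rewrite !(ipC _ z) ipDl rmorphD. Qed.

Lemma ip0r z : ip z 0 = 0.
Proof. by rewrite ipC ip0l conjc0. Qed.

Lemma ipZr a x z : ip z (a *: x) = conjc a * ip z x.
Proof. by rewrite !(ipC _ z) ipZl rmorphM. Qed.

Lemma ipNl x z : ip (- x) z = - ip x z.
Proof. by rewrite -scaleN1r ipZl mulN1r. Qed.

Lemma ipNr x z : ip z (- x) = - ip z x.
Proof. by rewrite !(ipC _ z) ipNl rmorphN. Qed.

Lemma ipBl x y z : ip (x - y) z = ip x z - ip y z.
Proof. by rewrite ipDl ipNl. Qed.

Lemma ipBr x y z : ip z (x - y) = ip z x - ip z y.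
Proof. by rewrite ipDr ipNr. Qed.

Lemma ip_suml (I : Type) (r : seq I) (P : pred I) (F : I -> V) z :
  ip (\sum_(i <- r | P i) F i) z = \sum_(i <- r | P i) ip (F i) z.
Proof. by apply: (big_morph (ip^~ z)) => [x y|]; rewrite ?ipDl ?ip0l. Qed.

Lemma ip_sumr (I : Type) (r : seq I) (P : pred I) (F : I -> V) z :
  ip z (\sum_(i <- r | P i) F i) = \sum_(i <- r | P i) ip z (F i).
Proof. by apply: (big_morph (ip z)) => [x y|]; rewrite ?ipDr ?ip0r. Qed.

Definition sqnorm x : R := Re (ip x x).

Lemma ipxx x : ip x x = (sqnorm x)%:C.
Proof.
have [_ [_ [/(_ x) + _]]] := ipP.
by rewrite lecE /= /sqnorm; case: (ip x x) => a b /= /andP[/eqP -> _].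
Qed.

Lemma sqnorm_ge0 x : 0 <= sqnorm x.
Proof. by have [_ [_ [/(_ x) + _]]] := ipP; rewrite ipxx ler0c. Qed.

Lemma sqnorm_eq0 x : sqnorm x = 0 -> x = 0.
Proof. by move=> x0; case: ipP => _ [_ [_]]; apply; rewrite ipxx x0. Qed.

Lemma hnorm_sqr x : hnorm ip x ^+ 2 = sqnorm x.
Proof. by rewrite sqr_sqrtr // sqnorm_ge0. Qed.

Lemma sqnormD x y : sqnorm (x + y) = sqnorm x + sqnorm y + 2 * Re (ip x y).
Proof.
rewrite /sqnorm ipDl !ipDr !ReD (ipC x y) ReJ; ring.
Qed.

Lemma sqnormZ a x : sqnorm (a *: x) = nsq a * sqnorm x.
Proof. by rewrite /sqnorm ipZl ipZr mulrA mulcJ_nsq ReZ. Qed.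

Lemma sqnormB x y : sqnorm (x - y) = sqnorm x + sqnorm y - 2 * Re (ip x y).
Proof.
rewrite sqnormD ipNr ReN /sqnorm ipNl ipNr opprK; ring.
Qed.

Lemma ip_sep x y : (forall z, ip x z = ip y z) -> x = y.
Proof.
move=> xy; apply/subr0_eq/sqnorm_eq0.
by rewrite /sqnorm ipBl xy subrr.
Qed.

(* An orthogonal family of vectors of norm at most 1: allowing null vectors
   makes all families indexed by [nat]. *)
Definition subon (e : nat -> V) :=
  (forall i j, i != j -> ip (e i) (e j) = 0) /\ (forall i, sqnorm (e i) <= 1).

(** Expand [|x - p|^2 >= 0] for the partial expansion [p] of [x]. As the [e j] have norm at most 1,
    [|p|^2] is only bounded by the sum of squared coefficients, which suffices. *)
Lemma bessel (e : nat -> V) (x : V) N : subon e ->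
  \sum_(j < N) nsq (ip x (e j)) <= sqnorm x.
Proof.
move=> [eo e1].
pose p := \sum_(j < N) ip x (e j) *: e j.
have xp : ip x p = (\sum_(j < N) nsq (ip x (e j)))%:C.
  rewrite ip_sumr rmorph_sum; apply: eq_bigr => j _.
  by rewrite ipZr mulrC mulcJ_nsq.
have pp : sqnorm p <= \sum_(j < N) nsq (ip x (e j)).
  rewrite /sqnorm {1}/p ip_suml Re_sum; apply: ler_sum => j _.
  rewrite ipZl ip_sumr (bigD1 j) //= big1 => [|k kj]; last first.
    by rewrite ipZr eo ?mulr0 // eq_sym.
  rewrite addr0 ipZr mulrA mulcJ_nsq ipxx -rmorphM /=.
  by rewrite ler_piMr // nsq_ge0.
have := sqnorm_ge0 (x - p); rewrite sqnormB xp /=.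
by move: pp; lra.
Qed.

Lemma cauchy_schwarz x y : nsq (ip x y) <= sqnorm x * sqnorm y.
Proof.
have [y0|y0] := eqVneq (sqnorm y) 0.
  by rewrite y0 (sqnorm_eq0 y0) ip0r /nsq /= expr0n /= addr0 mulr0.
have yp : 0 < sqnorm y by rewrite lt_def y0 sqnorm_ge0.
(* This is [|y|^2] times the component of [x] orthogonal to [y]; the scaling avoids a division. *)
have := sqnorm_ge0 ((sqnorm y)%:C *: x - ip x y *: y).
rewrite sqnormB !sqnormZ ipZl ipZr [conjc _ * _]mulrC mulcJ_nsq -rmorphM.
have -> : nsq (sqnorm y)%:C = sqnorm y ^+ 2 by rewrite /nsq /= expr0n /= addr0.
rewrite [Re _]/=; move: (nsq _) yp => q; nra.
Qed.

Definition orthonormal d (f : nat -> V) := forall i j,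
  (i < d)%N -> (j < d)%N -> ip (f i) (f j) = (i == j)%:R.

Definition onproj d (f : nat -> V) (x : V) : V :=
  \sum_(i < d) ip x (f i) *: f i.

Lemma onproj_linear d f : linear (onproj d f).
Proof.
move=> a x y; rewrite /onproj scaler_sumr -big_split /=.
by apply: eq_bigr => i _; rewrite ipDl ipZl scalerDl scalerA.
Qed.

Lemma ip_onproj d f x y :
  ip (onproj d f x) y = \sum_(i < d) ip x (f i) * conjc (ip y (f i)).
Proof. by rewrite ip_suml; apply: eq_bigr => i _; rewrite ipZl (ipC y). Qed.

Lemma onproj_sym d f x y : ip (onproj d f x) y = ip x (onproj d f y).
Proof.
rewrite ip_onproj (ipC _ x) ip_onproj rmorph_sum; apply: eq_bigr => i _.
by rewrite rmorphM /= conjcK mulrC.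
Qed.

Lemma ip_onproj_basis d f x i : orthonormal d f -> (i < d)%N ->
  ip (onproj d f x) (f i) = ip x (f i).
Proof.
move=> fo id; rewrite ip_suml (bigD1 (Ordinal id)) //= big1 => [|j ji].
  by rewrite addr0 ipZl fo // eqxx mulr1.
rewrite ipZl fo //; case: eqP => [jE|_]; last by rewrite mulr0.
by case/eqP: ji; apply: val_inj.
Qed.

Lemma onproj_idem d f x : orthonormal d f ->
  onproj d f (onproj d f x) = onproj d f x.
Proof.
move=> fo; rewrite {1}/onproj; apply: eq_bigr => i _.
by rewrite ip_onproj_basis.
Qed.

Lemma onproj_sqnorm d f x : orthonormal d f ->
  sqnorm x = sqnorm (onproj d f x) + sqnorm (x - onproj d f x).
Proof.
move=> fo; rewrite sqnormB -onproj_sym.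
have -> : ip (onproj d f x) x = ip (onproj d f x) (onproj d f x).
  by rewrite -onproj_sym onproj_idem.
by rewrite -/(sqnorm _); ring.
Qed.

Lemma onproj_R1plus d f : orthonormal d f -> R1plus ip (onproj d f).
Proof.
move=> fo; split; first exact: onproj_linear.
- by exists d, (fun i => f i) => x; exists (fun i => ip x (f i)).
move=> x.
have -> : ip (onproj d f x) x = (sqnorm (onproj d f x))%:C.
  by rewrite -ipxx -onproj_sym onproj_idem.
rewrite ler0c sqnorm_ge0 /= ipxx lecR (onproj_sqnorm x fo).
by rewrite lerDl sqnorm_ge0.
Qed.

(** Each new vector [v] contributes its normalized residual [r], unless [r = 0], when the projection
    at hand already fixes [v]. The conclusion is stated with the projection because later arguments
    only need a projection fixing finitely many vectors. *)
Lemma gram_schmidt (vs : seq V) : exists d f,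
  orthonormal d f /\ (forall v, v \in vs -> onproj d f v = v).
Proof.
elim: vs => [|v vs [d [f [fo fvs]]]]; first by exists 0%N, (fun=> 0).
pose r := v - onproj d f v.
have rf i : (i < d)%N -> ip r (f i) = 0.
  by move=> id; rewrite ipBl ip_onproj_basis // subrr.
have [r0|r0] := eqVneq r 0.
  exists d, f; split=> // w; rewrite inE => /orP[/eqP ->|/fvs //].
  by move/eqP: r0; rewrite subr_eq0 eq_sym => /eqP.
have rp : 0 < sqnorm r.
  by rewrite lt_def sqnorm_ge0 andbT; apply: contra_neq r0 => /sqnorm_eq0.
pose c := (Num.sqrt (sqnorm r))^-1.
pose g i := if (i < d)%N then f i else c%:C *: r.
have c2 : c ^+ 2 * sqnorm r = 1.
  by rewrite /c exprVn sqr_sqrtr ?ltW // mulVf // gt_eqF.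
have conjcR (a : R) : conjc a%:C = a%:C by rewrite conjc_real.
have go : orthonormal d.+1 g.
  move=> i j; rewrite !ltnS /g => id jd.
  case: ltnP => [id'|id']; case: ltnP => [jd'|jd'].
  - exact: fo.
  - rewrite ipZr (ipC r) rf // conjc0 mulr0.
    by rewrite ltn_eqF // (leq_trans id').
  - by rewrite ipZl rf // mulr0 gtn_eqF // (leq_trans jd').
  - rewrite ipZl ipZr conjcR ipxx -!rmorphM /= mulrA -expr2 c2.
    by have -> : i = j; [apply/eqP; rewrite eqn_leq !(leq_trans id, leq_trans jd)|rewrite eqxx].
have gE w : onproj d.+1 g w = onproj d f w + ip w (c%:C *: r) *: (c%:C *: r).
  rewrite /onproj big_ord_recr /= [g d]/g ltnn; congr (_ + _).
  by apply: eq_bigr => i _; rewrite /g ltn_ord.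
exists d.+1, g; split=> // w; rewrite inE => /orP[/eqP ->|wvs].
  rewrite gE.
  have -> : ip v (c%:C *: r) = c%:C * ip r r.
    rewrite ipZr conjcR; congr (_ * _).
    rewrite -[v in LHS](subrK (onproj d f v)) -/r ipDl [X in _ + X](_ : _ = 0) ?addr0 //.
    by rewrite ip_suml big1 // => i _; rewrite ipZl (ipC r) rf // conjc0 mulr0.
  rewrite ipxx scalerA -!rmorphM /= mulrAC -expr2 c2 scale1r.
  by rewrite /r addrC subrK.
rewrite gE fvs //.
have -> : ip w (c%:C *: r) = 0; last by rewrite scale0r addr0.
rewrite ipZr -(fvs _ wvs) ip_suml big1 ?mulr0 // => i _.
by rewrite ipZl (ipC r) rf // conjc0 mulr0.
Qed.

End InnerProduct.

(** * Singular value decomposition *)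

Section SingularValueDecomposition.
Variables (R : realType) (V : lmodType R[i]) (ip : V -> V -> R[i]).
Hypothesis ipP : is_inner_product ip.

(** The first clause makes [d] the exact rank: [s] is positive below [d] and zero from [d] on, like
    the padded sequence of singular values. *)
Definition svd (T : V -> V) d (s : nat -> R) (u v : nat -> V) :=
  [/\ forall l, 0 <= s l /\ (0 < s l) = (l < d)%N,
      forall j k, (j <= k)%N -> s k <= s j,
      orthonormal ip d u,
      orthonormal ip d v &
      forall x, T x = \sum_(l < d) ((s l)%:C * ip x (u l)) *: v l].

Lemma conjC_conjc (z : R[i]) : Num.conj z = conjc z.
Proof. by []. Qed.

(* With [g] the rows of a matrix, this diagonalizes its Gram matrix. *)
Lemma diagonalize_rank_one_sum r (g f : nat -> V) : orthonormal ip r f ->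
  exists u v : nat -> V,
  [/\ forall a b, (a < r)%N -> (b < r)%N -> a != b -> ip (u a) (u b) = 0,
      orthonormal ip r v &
      forall x, \sum_(k < r) ip x (g k) *: f k = \sum_(a < r) ip x (u a) *: v a].
Proof.
move=> fo.
pose G : 'M[R[i]]_r := \matrix_(k, l) ip (g k) (g l).
have GJ : (G ^t* = G)%sesqui.
  by apply/matrixP => k l; rewrite !mxE conjC_conjc -(ipC ipP).
have Gn : G \is normalmx by apply/normalmxP; rewrite GJ.
pose U := spectralmx G; have Uu : U \is unitarymx := spectral_unitarymx G.
have UG : U *m G *m (U ^t*)%sesqui = diag_mx (spectral_diag G).
  rewrite [G in LHS](orthomx_spectralP Gn) -/U -(invmx_unitary Uu) !mulmxA.
  by rewrite mulmxV ?unitarymx_unit // mul1mx -mulmxA mulmxV ?unitarymx_unit // mulmx1.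
(* The change of basis by [U], extended by 0 beyond index [r]; it turns a Gram matrix [H] into
   [U H U^*]. *)
pose lift (h : nat -> V) (a : nat) : V :=
  oapp (fun i : 'I_r => \sum_(k < r) U i k *: h k) 0 (insub a).
have liftE h (i : 'I_r) : lift h i = \sum_(k < r) U i k *: h k.
  by rewrite /lift valK.
have ip_lift h (i j : 'I_r) : ip (lift h i) (lift h j) =
    (U *m (\matrix_(k, l) ip (h k) (h l)) *m (U ^t*)%sesqui) i j.
  rewrite !liftE (ip_sumr ipP) mxE; apply: eq_bigr => l _.
  rewrite (ipZr ipP) mulrC (ip_suml ipP) !mxE; congr (_ * _).
  by apply: eq_bigr => k _; rewrite (ipZl ipP) mxE.
exists (lift g), (lift f); split.
- move=> a b ar br ab; rewrite (ip_lift g (Ordinal ar) (Ordinal br)) UG mxE.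
  by rewrite -val_eqE /= (negPf ab) mulr0n.
- move=> a b ar br; rewrite (ip_lift f (Ordinal ar) (Ordinal br)).
  have -> : \matrix_(k < r, l < r) ip (f k) (f l) = 1%:M.
    by apply/matrixP => k l; rewrite !mxE fo.
  by rewrite mulmx1 (unitarymxP Uu) mxE -val_eqE.
move=> x.
have UU : ((U ^t*)%sesqui *m U) = 1%:M.
  by rewrite -(invmx_unitary Uu) mulVmx // unitarymx_unit.
(* The sum over [a] is the entry [(k, l)] of [U^* U = 1], so only the terms with [l = k] survive. *)
transitivity (\sum_(k < r) \sum_(l < r) \sum_(a < r)
    (ip x (g k) * conjc (U a k) * U a l) *: f l); last first.
  under eq_bigr do rewrite exchange_big /=.
  rewrite exchange_big /=; apply: eq_bigr => a _.
  rewrite !liftE (ip_sumr ipP) scaler_suml; apply: eq_bigr => k _.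
  rewrite scaler_sumr; apply: eq_bigr => l _.
  by rewrite (ipZr ipP) scalerA [conjc _ * _]mulrC.
apply: eq_bigr => k _; rewrite (bigD1 k) //= [X in _ = _ + X]big1 ?addr0.
  rewrite -scaler_suml; congr (_ *: _).
  under eq_bigr do rewrite -mulrA.
  rewrite -mulr_sumr; have /matrixP/(_ k k) := UU; rewrite !mxE eqxx.
  under eq_bigr do rewrite !mxE conjC_conjc.
  by move=> ->; rewrite mulr1.
move=> l lk; rewrite -scaler_suml.
under eq_bigr do rewrite -mulrA.
rewrite -mulr_sumr; have /matrixP/(_ k l) := UU; rewrite !mxE eq_sym (negPf lk).
under eq_bigr do rewrite !mxE conjC_conjc.
by move=> ->; rewrite mulr0 scale0r.
Qed.

(** After diagonalization the [u a] are orthogonal and their lengths [lam a] are the singular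
    values. It remains to drop the zero lengths, sort the others and normalize. *)
Lemma svd_of_rank_one_sum T r (g f : nat -> V) : orthonormal ip r f ->
  (forall x, T x = \sum_(k < r) ip x (g k) *: f k) ->
  exists d s u v, svd T d s u v.
Proof.
move=> /(@diagonalize_rank_one_sum r g) [u [v [uo vo guv]]] TE.
pose lam a := Num.sqrt (sqnorm ip (u a)).
pose js := sort (fun a b => lam b <= lam a) [seq a <- iota 0 r | 0 < lam a].
have js_perm : perm_eq js [seq a <- iota 0 r | 0 < lam a].
  by rewrite /js perm_sort.
have js_uniq : uniq js by rewrite sort_uniq filter_uniq // iota_uniq.
have js_mem a : a \in js -> (a < r)%N /\ 0 < lam a.
  by rewrite (perm_mem js_perm) mem_filter mem_iota /= add0n => /andP[].
pose d := size js; pose j l := nth 0%N js l.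
have jr l : (l < d)%N -> (j l < r)%N /\ 0 < lam (j l).
  by move=> ld; apply: js_mem; rewrite mem_nth.
pose s l := if (l < d)%N then lam (j l) else 0.
have s_pos l : (l < d)%N -> 0 < s l by move=> ld; rewrite /s ld; case: (jr _ ld).
have jI a b : (a < d)%N -> (b < d)%N -> (j a == j b) = (a == b).
  by move=> ad bd; rewrite nth_uniq.
exists d, s, (fun l => (s l)^-1%:C *: u (j l)), (v \o j); split.
- move=> l; rewrite /s; case: ifP => ld; last by rewrite ltxx.
  by have [_ lp] := jr _ ld; rewrite ltW.
- move=> a b ab; case: (ltnP b d) => bd; last first.
    rewrite {1}/s ltnNge bd /= /s; case: ifP => // ad.
    by case: (jr _ ad) => _ /ltW.
  rewrite /s bd (leq_ltn_trans ab bd).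
  have js_sorted : sorted (fun a b => lam b <= lam a) js.
    by apply: sort_sorted => x y; apply: le_total.
  apply: (sorted_leq_nth _ _ 0%N js_sorted) => //.
  + by move=> y x z xy yz; apply: le_trans yz xy.
  + exact: leq_ltn_trans ab bd.
- move=> a b ad bd; rewrite (ipZl ipP) (ipZr ipP) conjc_real.
  have [<-|ab] := eqVneq a b; last first.
    by rewrite uo ?mulr0 ?jI //; [case: (jr a ad)|case: (jr b bd)].
  rewrite (ipxx ipP) -!rmorphM /= mulrA -expr2.
  have -> : sqnorm ip (u (j a)) = s a ^+ 2.
    by rewrite /s ad /lam sqr_sqrtr // sqnorm_ge0.
  by rewrite -exprMn mulVf ?expr1n // gt_eqF // s_pos.
- move=> a b ad bd; rewrite /= vo ?jI //; first by case: (jr _ ad).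
  by case: (jr _ bd).
move=> x; rewrite TE guv.
transitivity (\sum_(a <- js) ip x (u a) *: v a).
  rewrite (perm_big _ js_perm) /= big_filter -(big_mkord xpredT (fun a => ip x (u a) *: v a)).
  rewrite /index_iota subn0 [RHS]big_mkcond; apply: eq_bigr => a _.
  case: ifP => // /negbT; rewrite -leNgt /lam => a0.
  have : Num.sqrt (sqnorm ip (u a)) == 0 by rewrite eq_le a0 sqrtr_ge0.
  rewrite sqrtr_eq0 => a0'.
  rewrite (sqnorm_eq0 ipP (x := u a)) ?(ip0r ipP) ?scale0r //.
  by apply/eqP; rewrite eq_le a0' sqnorm_ge0.
rewrite (big_nth 0%N) big_mkord; apply: eq_bigr => l _.
rewrite (ipZr ipP) conjc_real mulrA -rmorphM /= divff ?mul1r //.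
by rewrite gt_eqF // s_pos.
Qed.

Definition adjoint (T T' : V -> V) := forall x y, ip (T x) y = ip x (T' y).

Lemma finite_rank_fixed T : finite_rank T -> exists vs : seq V, forall d f,
  (forall v, v \in vs -> onproj ip d f v = v) ->
  forall x, onproj ip d f (T x) = T x.
Proof.
move=> [k [w Tw]]; exists [seq w i | i <- enum 'I_k] => d f fw x.
have [c ->] := Tw x; have ol := onproj_linear ipP d f.
rewrite (linear_big ol); apply: eq_bigr => i _.
by rewrite (linear_scale ol) fw // map_f // mem_enum.
Qed.

(** If the projection onto the span of [f] fixes the range of [T], then [T x] is the sum of
    [<T x, f_k> f_k = <x, T' f_k> f_k], a sum of rank one operators. *)
Lemma svd_exists T T' : finite_rank T -> adjoint T T' ->
  exists d s u v, svd T d s u v.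
Proof.
move=> /finite_rank_fixed[vs Tvs] TT'.
have [r [f [fo fvs]]] := gram_schmidt ipP vs.
apply: (@svd_of_rank_one_sum T r (T' \o f) f fo) => x.
by rewrite -[LHS](Tvs _ _ fvs); apply: eq_bigr => i _; rewrite TT'.
Qed.

End SingularValueDecomposition.

(** * Singular values and the Lorentz norm *)

(** If [k > c], the [k] by [c] coefficient matrix has a nonzero row vector in its left kernel, which
    is a linear relation among the [w i]. *)
Lemma linindep_card_le (R : realType) (V : lmodType R[i]) k c
    (w : 'I_k -> V) (v : 'I_c -> V) (a : 'I_k -> 'I_c -> R[i]) :
  (forall i, w i = \sum_(j < c) a i j *: v j) -> linindep w -> (k <= c)%N.
Proof.
move=> wE wi; rewrite leqNgt; apply/negP => ck.
pose M : 'M[R[i]]_(k, c) := \matrix_(i, j) a i j.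
have : kermx M != 0.
  rewrite kermx_eq0; apply: contraTN ck => /eqP Mk.
  by rewrite -leqNgt -Mk rank_leq_col.
move=> /rowV0Pn[b /sub_kermxP bM /eqP]; apply; apply/rowP => i; rewrite mxE.
apply: (wi (fun i => b 0 i)).
under eq_bigr do rewrite wE scaler_sumr.
rewrite exchange_big big1 //= => j _.
under eq_bigr do rewrite scalerA.
rewrite -scaler_suml; have /matrixP/(_ 0 j) := bM; rewrite !mxE.
by under eq_bigr do rewrite mxE; move=> ->; rewrite scale0r.
Qed.

Lemma card_eq_uniq_seq (js : seq nat) (A : set nat) :
  uniq js -> (forall j, A j <-> j \in js) -> (A #= `I_(size js))%card.
Proof.
move=> ju Aj.
have -> : A = (nth 0%N js @` `I_(size js))%classic.
  apply/seteqP; split=> j.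
    by move/Aj => jj; exists (index j js); rewrite /= ?index_mem ?nth_index.
  by move=> [i /= ij <-]; apply/Aj; rewrite mem_nth.
apply: inj_card_eq => i k; rewrite !inE /= => ij kj /eqP.
by rewrite nth_uniq // => /eqP.
Qed.

Section SingularValues.
Variables (R : realType) (V : lmodType R[i]) (ip : V -> V -> R[i]).
Hypothesis ipP : is_inner_product ip.
Variables (T : V -> V) (d : nat) (s : nat -> R) (u v : nat -> V).
Hypothesis T_svd : svd ip T d s u v.

Lemma svd_ge0 l : 0 <= s l.
Proof. by case: T_svd => /(_ l)[]. Qed.

Lemma svd_eq0 l : (d <= l)%N -> s l = 0.
Proof.
case: T_svd => /(_ l)[s0 sl] _ _ _ _ dl.
by apply/eqP; rewrite eq_le s0 andbT leNgt sl ltnNge dl.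
Qed.

Lemma svd_ip x y :
  ip (T x) (T y) = \sum_(l < d) (s l ^+ 2)%:C * (ip x (u l) * ip (u l) y).
Proof.
case: T_svd => _ _ _ vo TE.
rewrite (TE x) (ip_suml ipP); apply: eq_bigr => l _.
rewrite (ipZl ipP) (TE y) (ip_sumr ipP) (bigD1 l) //= big1 ?addr0 => [|k kl].
  rewrite (ipZr ipP) vo // eqxx mulr1 conjcM conjc_real -(ipC ipP).
  by rewrite expr2 [in RHS]rmorphM /=; ring.
rewrite (ipZr ipP) vo //; case: eqP => [/val_inj|_]; last by rewrite mulr0.
by move=> lk; rewrite lk eqxx in kl.
Qed.

Lemma svd_image_basis l : (l < d)%N -> T (u l) = (s l)%:C *: v l.
Proof.
case: T_svd => _ _ uo _ TE ld.
rewrite TE (bigD1 (Ordinal ld)) //= big1 ?addr0 => [|k kl].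
  by rewrite uo // eqxx mulr1.
rewrite uo //; case: eqP => [lk|_]; last by rewrite mulr0 scale0r.
by case/eqP: kl; apply: val_inj.
Qed.

(** The eigenspace for [lam > 0] has as basis the [u l] with [s l = lam], so its dimension is the
    number of such [l]. *)
Lemma svd_is_singular_values : is_singular_values ip T s.
Proof.
have [s_pos s_dec uo vo TE] := T_svd.
split=> // [j|lam lam0 k]; first exact: svd_ge0.
pose js := [seq j <- iota 0 d | s j == lam].
have js_uniq : uniq js by rewrite filter_uniq // iota_uniq.
have js_mem j : j \in js = (s j == lam) && (j < d)%N.
  by rewrite mem_filter mem_iota /= add0n.
have level_card : ([set j | s j = lam] #= `I_(size js))%card.
  apply: card_eq_uniq_seq => // j; rewrite js_mem /=; split=> [sj|/andP[/eqP //]].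
  by rewrite sj eqxx /=; case: (s_pos j) => _ <-; rewrite sj.
have nth_js (i : 'I_(size js)) : s (nth 0%N js i) = lam /\ (nth 0%N js i < d)%N.
  have : nth 0%N js i \in js by rewrite mem_nth.
  by rewrite js_mem => /andP[/eqP].
pose e (i : 'I_(size js)) := u (nth 0%N js i).
have eo i j : ip (e i) (e j) = (i == j)%:R.
  by rewrite uo ?nth_uniq //; case: (nth_js i) (nth_js j) => [_ ?] [].
have eig_dim : has_dim (abs_eigenspace ip T lam) (size js).
  split.
    exists e; split=> [i y|c ce i].
      rewrite svd_ip; have [<- id] := nth_js i.
      rewrite (bigD1 (Ordinal id)) //= big1 ?addr0 => [|k0 kl].
        by rewrite uo // eqxx mul1r.
      rewrite uo //; case: eqP => [lk|_]; last by rewrite mul0r mulr0.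
      by case/eqP: kl; apply: val_inj.
    have := congr1 (fun x => ip x (e i)) ce.
    rewrite (ip_suml ipP) (ip0l ipP) (bigD1 i) //= big1 ?addr0 => [|j ji].
      by rewrite (ipZl ipP) eo eqxx mulr1.
    by rewrite (ipZl ipP) eo (negPf ji) mulr0.
  move=> n w wE; apply: (@linindep_card_le _ _ _ _ w e (fun i j => ip (w i) (e j))).
  move=> i; set x := w i; have xE : abs_eigenspace ip T lam x := wE i.
  have lam2 : (lam ^+ 2)%:C != 0 :> R[i].
    by rewrite -(rmorph0 (real_complex R)) (inj_eq (@complexI _)) sqrf_eq0 gt_eqF.
  (* Tested against [u l], the eigenvalue equation reads [s_l^2 <x, u_l> = lam^2 <x, u_l>]. *)
  have x_u l : (l < d)%N -> s l != lam -> ip x (u l) = 0.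
    move=> ld; apply: contra_neq_eq => xl.
    have := xE (u l); rewrite svd_ip (bigD1 (Ordinal ld)) //= big1 ?addr0.
      rewrite uo // eqxx mulr1 => /(mulIf xl) /complexI /eqP.
      by rewrite eqrXn2 ?svd_ge0 ?ltW // => /eqP.
    move=> k0 kl; rewrite uo //; case: eqP => [lk|_]; last by rewrite !mulr0.
    by case/eqP: kl; apply: val_inj.
  apply: (ip_sep ipP) => y; apply: (mulfI lam2); rewrite -xE svd_ip.
  transitivity (\sum_(l <- js) (lam ^+ 2)%:C * (ip x (u l) * ip (u l) y)).
    rewrite big_filter -(big_mkord xpredT
      (fun l => (s l ^+ 2)%:C * (ip x (u l) * ip (u l) y))).
    rewrite /index_iota subn0 [RHS]big_mkcond; apply: eq_big_seq => l.
    rewrite mem_iota /= add0n => ld; case: eqP => [->//|/eqP sl].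
    by rewrite x_u // mul0r mulr0.
  rewrite (big_nth 0%N) big_mkord (ip_suml ipP) mulr_sumr.
  by apply: eq_bigr => j _; rewrite (ipZl ipP).
split=> [kc|kd].
  have /card_eq_II <- // : (`I_(size js) #= `I_k)%card.
  exact: card_eq_trans (card_esym level_card) kc.
have -> // : k = size js.
case: kd eig_dim => [[w [wS wi]] wmax] [[w' [wS' wi']] wmax'].
by apply/eqP; rewrite eqn_leq (wmax' _ w) // (wmax _ w').
Qed.

End SingularValues.

Section SingularValuesUniqueness.
Variables (R : realType) (V : lmodType R[i]) (ip : V -> V -> R[i]).

(** Otherwise put [lam = s' j > s j]. By monotonicity [s] takes the value [lam] only below [j],
    where it agrees with [s']; so [s'] takes it at least once more, although both multiplicities are
    the dimension of the same eigenspace. *)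
Lemma is_singular_values_le (T : V -> V) s s' j :
  is_singular_values ip T s -> is_singular_values ip T s' ->
  (forall k, (k < j)%N -> s k = s' k) -> s' j <= s j.
Proof.
move=> [s0 sd sc] [s'0 s'd s'c] ss'; rewrite leNgt; apply/negP => slt.
pose lam := s' j; have lam0 : 0 < lam by apply: le_lt_trans slt.
pose js := [seq k <- iota 0 j | s k == lam].
have js_mem k : k \in js = (s k == lam) && (k < j)%N.
  by rewrite mem_filter mem_iota /= add0n.
have js_card : ([set k | s k = lam] #= `I_(size js))%card.
  apply: card_eq_uniq_seq => [|k].
    by rewrite filter_uniq // iota_uniq.
  rewrite js_mem; split=> [/= sk|/andP[/eqP //]].
  rewrite sk eqxx /= ltnNge; apply/negP => jk.
  by have := le_lt_trans (sd _ _ jk) slt; rewrite sk ltxx.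
have card' : ([set k | s' k = lam] #= `I_(size js))%card.
  by apply/s'c/sc.
have : (`I_(size js).+1 #<= [set k | s' k = lam])%card.
  have AS : ([set k | s k = lam] `|` [set j] #= `I_(size js).+1)%card.
    apply/eq_cardSP; exists j; first by right.
    suff -> : (([set k | s k = lam] `|` [set j]) `\ j = [set k | s k = lam])%classic by [].
    apply/seteqP; split=> [k [[//|->]] []//|k /= sk]; split; first by left.
    by move=> kj; move: slt; rewrite -kj sk /lam -kj ltxx.
  rewrite -(card_le_eql AS); apply: subset_card_le => k [/= sk|->//].
  rewrite -ss' // ltnNge; apply/negP => jk.
  by have := le_lt_trans (sd _ _ jk) slt; rewrite sk ltxx.
by rewrite (card_le_eqr card') card_le_II ltnn.
Qed.

Lemma is_singular_values_unique (T : V -> V) s s' :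
  is_singular_values ip T s -> is_singular_values ip T s' -> s = s'.
Proof.
move=> sT s'T; apply/funext; elim/ltn_ind => j IH.
apply/eqP; rewrite eq_le (is_singular_values_le sT s'T) //.
by rewrite (is_singular_values_le s'T sT) // => k /IH.
Qed.

End SingularValuesUniqueness.

Section LorentzNorm.
Variables (R : realType) (V : lmodType R[i]) (ip : V -> V -> R[i]).
Hypothesis ipP : is_inner_product ip.

Definition lorentz_weight (p : \bar R) (j : nat) : R :=
  powR (j.+1)%:R (invp p - 1).

Lemma svd_lorentz_norm p T d s u v : svd ip T d s u v ->
  lorentz_norm ip p T = (\sum_(j < d) lorentz_weight p j * s j)%:E.
Proof.
move=> Ts; rewrite /lorentz_norm.
(* [sing_vals] is a choice; existence and uniqueness identify it with the [s] of any
   decomposition. *)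
have -> : sing_vals ip T = s.
  apply: is_singular_values_unique (svd_is_singular_values ipP Ts).
  apply: ClassicalEpsilon.epsilon_spec; exists s.
  exact: svd_is_singular_values Ts.
rewrite (nneseries_split _ d) => [|k _]; last first.
  by rewrite lee_fin mulr_ge0 ?powR_ge0 ?(svd_ge0 Ts).
rewrite add0n [X in (_ + X)%E]eseries0 ?adde0 => [|k dk _]; last first.
  by rewrite (svd_eq0 Ts) ?mul0r.
by rewrite sumEFin big_mkord; congr EFin; apply: eq_bigr => j _; rewrite mulrC.
Qed.

Lemma lorentz_weight_ge0 p j : 0 <= lorentz_weight p j.
Proof. exact: powR_ge0. Qed.

Lemma invp_le1 (p : \bar R) : (1 <= p)%E -> invp p <= 1.
Proof.
case: p => [r| |] //=; rewrite lee_fin => r1.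
by rewrite invf_le1 // (lt_le_trans _ r1).
Qed.

Lemma lorentz_weight_decr p j k : (1 <= p)%E -> (j <= k)%N ->
  lorentz_weight p k <= lorentz_weight p j.
Proof.
move=> /invp_le1 p1 jk; rewrite /lorentz_weight -(opprB 1) !powRN.
rewrite lef_pV2 ?posrE ?powR_gt0 //.
by rewrite ge0_ler_powR ?nnegrE ?subr_ge0 // ler_nat.
Qed.

Lemma lorentz_weight0 (p : \bar R) : lorentz_weight p 0 = 1.
Proof. by rewrite /lorentz_weight powR1. Qed.

(* The weight of the last index of the [l]-th block of length [m]. *)
Lemma lorentz_weight_block (p : \bar R) m l : (0 < m)%N ->
  m%:R * lorentz_weight p (l.+1 * m).-1 = powR m%:R (invp p) * lorentz_weight p l.
Proof.
move=> m0; rewrite /lorentz_weight prednK ?muln_gt0 // mulnC natrM powRM //.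
rewrite mulrA; congr (_ * _); rewrite -[in RHS](subrK 1 (invp p)) [in RHS]addrC.
by rewrite [in RHS]powRD ?powRr1 // pnatr_eq0 -lt0n m0 implybT.
Qed.

End LorentzNorm.

(** * Ky Fan's principle *)

(** Summation by parts as an induction: lowering the weight of a nonnegative partial sum from [w N]
    to [w N.+1] only decreases it. *)
Lemma abel_sum_ge (R : numDomainType) (w a : nat -> R) N :
  (forall j k, (j <= k)%N -> w k <= w j) ->
  (forall k, 0 <= \sum_(j < k) a j) ->
  w N * \sum_(j < N) a j <= \sum_(j < N) w j * a j.
Proof.
move=> w_dec a_ge0; elim: N => [|N IH]; first by rewrite !big_ord0 mulr0.
apply: (@le_trans _ _ (w N * \sum_(j < N.+1) a j)); first by rewrite ler_wpM2r ?w_dec.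
by rewrite !big_ord_recr mulrDr lerD2r.
Qed.

Section KyFan.
Variables (R : realType) (V : lmodType R[i]) (ip : V -> V -> R[i]).
Hypothesis ipP : is_inner_product ip.

(** Zero vectors beyond [d] turn an orthonormal family of length [d] into a [subon] family on all of
    [nat]. *)
Definition truncate d (f : nat -> V) l : V := if (l < d)%N then f l else 0.

Lemma subon_truncate d f : orthonormal ip d f -> subon ip (truncate d f).
Proof.
move=> fo; rewrite /truncate; split=> [i j ij|i].
  case: ifP => id; last by rewrite (ip0l ipP).
  by case: ifP => jd; rewrite ?(ip0r ipP) // fo // (negPf ij).
by case: ifP => id; rewrite /sqnorm ?(ip0r ipP) ?fo ?eqxx //= ler01.
Qed.

Lemma nsq_ipC x y : nsq (ip x y) = nsq (ip y x).
Proof. by rewrite (ipC ipP) nsqJ. Qed.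

Section OneOperator.
Variables (T : V -> V) (d : nat) (s : nat -> R) (u v : nat -> V).
Hypothesis T_svd : svd ip T d s u v.

(** The left side is at most the sum of [s_l c_l] with [0 <= c_l <= 1] and total mass at most [k];
    since [s] decreases, placing the mass on the first [k] indices is optimal. *)
Lemma ky_fan (e f : nat -> V) k : subon ip e -> subon ip f ->
  \sum_(j < k) Re (ip (T (e j)) (f j)) <= \sum_(l < k) s l.
Proof.
move=> eo fo; have [_ s_dec uo vo TE] := T_svd.
have s_ge0 := svd_ge0 T_svd.
(* [c l] comes from [Re (z w) <= (|z|^2 + |w|^2) / 2] for [z = <e_j, u_l>], [w = <v_l, f_j>]. Bessel
   in [j] gives [c l <= 1], and Bessel in [l] bounds the total mass. *)
pose c (l : nat) :=
  \sum_(j < k) (nsq (ip (e j) (u l)) + nsq (ip (v l) (f j))) / 2.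
have c_ge0 l : 0 <= c l.
  by apply: sumr_ge0 => j _; rewrite divr_ge0 // addr_ge0 // nsq_ge0.
have c_le1 l : (l < d)%N -> c l <= 1.
  move=> ld; rewrite /c -mulr_suml big_split /=.
  under eq_bigr do rewrite nsq_ipC.
  have := bessel ipP (u l) k eo; have := bessel ipP (v l) k fo.
  rewrite /sqnorm uo // vo // eqxx /=. lra.
have c_sum : \sum_(l < d) c l <= k%:R.
  rewrite exchange_big -[k in leRHS]card_ord -sumr_const; apply: ler_sum => j _.
  rewrite -mulr_suml big_split /=.
  have := bessel ipP (e j) d (subon_truncate uo).
  have := bessel ipP (f j) d (subon_truncate vo).
  have tr (x : V) g : \sum_(l < d) nsq (ip x (truncate d g l)) =
      \sum_(l < d) nsq (ip x (g l)).
    by apply: eq_bigr => l _; rewrite /truncate ltn_ord.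
  rewrite !tr [X in X <= _ -> _](eq_bigr (fun l : 'I_d => nsq (ip (v l) (f j)))).
    by have := eo.2 j; have := fo.2 j; lra.
  by move=> l _; exact: nsq_ipC.
have step1 : \sum_(j < k) Re (ip (T (e j)) (f j)) <= \sum_(l < d) s l * c l.
  rewrite [leRHS](eq_bigr (fun l : 'I_d => \sum_(j < k)
      s l * ((nsq (ip (e j) (u l)) + nsq (ip (v l) (f j))) / 2))); last first.
    by move=> l _; rewrite mulr_sumr.
  rewrite exchange_big /=; apply: ler_sum => j _.
  rewrite TE (ip_suml ipP) Re_sum; apply: ler_sum => l _.
  rewrite (ipZl ipP) -mulrA ReZ ler_wpM2l //.
  exact: Re_mul_le.
apply: (le_trans step1).
(* Compare with the level [s k]: the excess [s l - s k] is positive only for [l < k], where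
   [c l <= 1]. Elsewhere [s l <= s k]. *)
apply: (@le_trans _ _ (\sum_(l < d) (s k * c l + if (l < k)%N then s l - s k else 0))).
  apply: ler_sum => l _; have := c_le1 _ (ltn_ord l); have := c_ge0 l.
  case: ltnP => lk c0 c1; first by have := s_dec _ _ (ltnW lk); nra.
  by have := s_dec _ _ lk; nra.
rewrite big_split /= -mulr_sumr.
have cut : \sum_(l < d) (if (l < k)%N then s l - s k else 0) <= \sum_(l < k) (s l - s k).
  rewrite -(big_mkord xpredT (fun l => s l - s k)).
  rewrite -(big_mkord xpredT (fun l => if (l < k)%N then s l - s k else 0)).
  have term_ge0 l : (l < k)%N -> 0 <= s l - s k.
    by move=> lk; rewrite subr_ge0 s_dec // ltnW.
  have [dk|kd] := leqP d k.
    rewrite [leRHS](big_cat_nat (leq0n d) dk) /= -[leLHS]addr0.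
    apply: lerD; last first.
      by rewrite big_nat_cond sumr_ge0 // => l /andP[/andP[_ /term_ge0]].
    by apply: ler_sum_nat => l /andP[_ ld]; rewrite (leq_trans ld dk).
  rewrite (big_cat_nat (leq0n k) (ltnW kd)) /= [X in _ + X]big_nat_cond.
  rewrite [X in _ + X]big1 ?addr0.
    by apply: ler_sum_nat => l /andP[_ lk]; rewrite lk.
  by move=> l /andP[/andP[kl _] _]; rewrite ltnNge kl.
have : s k * \sum_(l < d) c l <= s k * k%:R by rewrite ler_wpM2l.
move: cut; rewrite [X in _ <= X -> _]sumrB sumr_const card_ord -mulr_natr.
lra.
Qed.

(** Abel summation applies to the differences [s_j - Re <T e_j, f_j>], whose partial sums are
    nonnegative by [ky_fan]. The lengths [N] and [d] may differ because [s] vanishes from [d] on. *)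
Lemma ky_fan_weighted (w : nat -> R) (e f : nat -> V) N :
  (forall j, 0 <= w j) -> (forall j k, (j <= k)%N -> w k <= w j) ->
  subon ip e -> subon ip f ->
  \sum_(j < N) w j * Re (ip (T (e j)) (f j)) <= \sum_(l < d) w l * s l.
Proof.
move=> w0 w_dec eo fo.
have partial k : 0 <= \sum_(j < k) (s j - Re (ip (T (e j)) (f j))).
  by rewrite sumrB subr_ge0 ky_fan.
apply: (@le_trans _ _ (\sum_(j < N) w j * s j)).
  pose a j := s j - Re (ip (T (e j)) (f j)).
  rewrite -subr_ge0 -sumrB; under eq_bigr do rewrite -mulrBr.
  by apply: le_trans (@abel_sum_ge _ w a N w_dec partial); rewrite mulr_ge0 ?partial.
have ws l : 0 <= w l * s l by rewrite mulr_ge0 // (svd_ge0 T_svd).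
rewrite -!(big_mkord xpredT (fun l => w l * s l)).
have [Nd|dN] := leqP N d.
  by rewrite [leRHS](big_cat_nat (leq0n N) Nd) /= lerDl sumr_ge0.
rewrite [leLHS](big_cat_nat (leq0n d) (ltnW dN)) /= gerDl big_nat_cond big1 //.
by move=> l /andP[/andP[dl _] _]; rewrite (svd_eq0 T_svd) ?mulr0.
Qed.

(** The bound of [ky_fan_weighted] is attained at the singular vectors. *)
Lemma svd_weighted_sum (w : nat -> R) :
  \sum_(l < d) w l * s l =
  \sum_(l < d) w l * Re (ip (T (truncate d u l)) (truncate d v l)).
Proof.
have [_ _ _ vo _] := T_svd.
apply: eq_bigr => l _; rewrite /truncate ltn_ord (svd_image_basis T_svd) //.
by rewrite (ipZl ipP) vo // eqxx mulr1.
Qed.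

Lemma svd_top_le M : 0 <= M ->
  (forall x, sqnorm ip (T x) <= M ^+ 2 * sqnorm ip x) -> s 0 <= M.
Proof.
move=> M0 TM; have [d0|d0] := posnP d; first by rewrite (svd_eq0 T_svd) ?d0.
have [_ _ uo vo _] := T_svd.
have := TM (u 0%N); rewrite (svd_image_basis T_svd) // (sqnormZ ipP).
rewrite /sqnorm uo // vo // eqxx /= !mulr1 /nsq /= expr0n addr0.
by rewrite ler_pXn2r ?nnegrE ?(svd_ge0 T_svd).
Qed.

End OneOperator.

(** Convexity of the weighted sum: the singular vectors of [T] are tested in every [D k], where Ky
    Fan's principle gives at most [B]. *)
Lemma svd_average_le (N : nat) (D : 'I_N -> V -> V) (T : V -> V) d s u v
    (w : nat -> R) B :
  (forall j, 0 <= w j) -> (forall j k, (j <= k)%N -> w k <= w j) ->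
  (0 < N)%N -> svd ip T d s u v ->
  (forall x, T x = (N%:R^-1)%:C *: \sum_(k < N) D k x) ->
  (forall k, exists d' s' u' v', svd ip (D k) d' s' u' v' /\
    \sum_(l < d') w l * s' l <= B) ->
  \sum_(l < d) w l * s l <= B.
Proof.
move=> w0 w_dec N0 Ts TE Dk; have [_ _ uo vo _] := Ts.
rewrite (svd_weighted_sum Ts) -(ler_pM2l (_ : 0 < N%:R)) ?ltr0n // mulr_sumr.
have -> : \sum_(l < d) N%:R * (w l * Re (ip (T (truncate d u l)) (truncate d v l))) =
    \sum_(k < N) \sum_(l < d) w l * Re (ip (D k (truncate d u l)) (truncate d v l)).
  rewrite exchange_big; apply: eq_bigr => l _.
  rewrite TE (ipZl ipP) ReZ (ip_suml ipP) Re_sum -mulr_sumr.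
  by rewrite mulrCA; congr (_ * _); rewrite mulrA divff ?mul1r // pnatr_eq0 -lt0n.
rewrite mulr_natl -[N in leRHS]card_ord -sumr_const; apply: ler_sum => k _.
have [d' [s' [u' [v' [Ds]]]]] := Dk k; apply: le_trans.
by apply: (ky_fan_weighted Ds) => //; apply: subon_truncate.
Qed.

End KyFan.

(** * Finite-rank operators and adjoints *)

Section FiniteRank.
Variables (R : realType) (V : lmodType R[i]).
Implicit Types (A B T : V -> V).

Lemma finite_rank_add A B : finite_rank A -> finite_rank B ->
  finite_rank (fun x => A x + B x).
Proof.
move=> [d [v Av]] [e [w Bw]].
pose glue (T : Type) (f : 'I_d -> T) (g : 'I_e -> T) (i : 'I_(d + e)) :=
  match fintype.split i with inl j => f j | inr j => g j end.
exists (d + e)%N, (glue _ v w) => x; have [a ->] := Av x; have [b ->] := Bw x.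
exists (glue _ a b); rewrite big_split_ord /=.
congr (_ + _); apply: eq_bigr => j _; rewrite /glue.
  by rewrite (unsplitK (inl j)).
by rewrite (unsplitK (inr j)).
Qed.

Lemma finite_rank_zero : finite_rank (fun=> 0 : V).
Proof. by exists 0%N, (fun=> 0) => x; exists (fun=> 0); rewrite big_ord0. Qed.

Lemma finite_rank_compl (W : lmodType R[i]) (L : V -> W) (M : W -> V) A :
  linear L -> finite_rank A -> finite_rank (L \o A \o M).
Proof.
move=> Ll [d [v Av]]; exists d, (L \o v) => x; have [c /= ->] := Av (M x).
exists c; rewrite (linear_big Ll); apply: eq_bigr => i _.
by rewrite (linear_scale Ll).
Qed.

Lemma finite_rank_sum (I : Type) (r : seq I) (F : I -> V -> V) :
  (forall i, finite_rank (F i)) -> finite_rank (fun x => \sum_(i <- r) F i x).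
Proof.
move=> Ff; elim: r => [|i r IH].
  by under eq_fun do rewrite big_nil; exact: finite_rank_zero.
by under eq_fun do rewrite big_cons; exact: finite_rank_add.
Qed.

Lemma finite_rank_scale a A : finite_rank A -> finite_rank (fun x => a *: A x).
Proof.
move=> [d [v Av]]; exists d, v => x; have [c ->] := Av x.
by exists (fun i => a * c i); rewrite scaler_sumr; under eq_bigr do rewrite scalerA.
Qed.

Lemma finite_rank_commut n (T : 'I_n -> V -> V) A i :
  (forall i, linear (T i)) -> finite_rank A -> finite_rank (commut T A i).
Proof.
move=> Tl Af; rewrite /commut.
under eq_fun do rewrite -scaleN1r.
apply: finite_rank_add; first exact: (finite_rank_compl id (Tl i) Af).
by apply: finite_rank_scale; exact: (@finite_rank_compl _ id (T i)).
Qed.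

End FiniteRank.

(** * Adjoints, positive contractions and averages *)

Section Adjoints.
Variables (R : realType) (V : lmodType R[i]) (ip : V -> V -> R[i]).
Hypothesis ipP : is_inner_product ip.
Implicit Types (A B T P : V -> V).

(** Polarization over the complex numbers: the defect [h] vanishes on the diagonal, hence is
    antisymmetric; replacing [y] by [i y] makes it symmetric too, so [2 h = 0]. *)
Lemma positive_sym A : linear A -> (forall x, 0 <= ip (A x) x) -> adjoint ip A A.
Proof.
move=> Al A0.
pose h x y := ip (A x) y - ip x (A y).
have hxx x : h x x = 0.
  rewrite /h (ipC ipP (A x)); have := ger0_Im (A0 x).
  by case: (ip (A x) x) => a b /= ->; rewrite oppr0 subrr.
have hD x y : h x y + h y x = 0.
  have := hxx (x + y).
  rewrite /h (linear_add Al) !(ipDl ipP) !(ipDr ipP) => e.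
  have := hxx x; have := hxx y; rewrite /h => ey ex.
  by rewrite -[RHS]e -[LHS]addr0 -[in LHS]ex -[LHS]addr0 -[in LHS]ey; ring.
have hi x y : h x ('i%C *: y) = - 'i%C * h x y.
  by rewrite /h (linear_scale Al) !(ipZr ipP) mulrBr /=; simpc.
have hil x y : h ('i%C *: x) y = 'i%C * h x y.
  by rewrite /h (linear_scale Al) !(ipZl ipP) mulrBr.
move=> x y; apply/eqP; rewrite -subr_eq0 -/(h x y); apply/eqP.
have e1 := hD x y; have := hD x ('i%C *: y); rewrite hi hil => e2.
have i0 : ('i%C : R[i]) != 0 by rewrite eq_complex /= oner_eq0 andbF.
have e3 : h y x = h x y.
  by apply: (mulfI i0); apply/eqP; rewrite -subr_eq0 -mulNr addrC; apply/eqP.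
have : h x y *+ 2 = 0 by rewrite mulr2n -{2}e3.
by move=> /eqP; rewrite mulrn_eq0 /= => /eqP.
Qed.

Lemma R1plus_sym A : R1plus ip A -> adjoint ip A A.
Proof.
by move=> [Al _ A01]; apply: positive_sym => // x; case/andP: (A01 x).
Qed.

(** By symmetry [A = P A] gives [A = P A P], and [A <= I] gives [P A P <= P^2 = P]. *)
Lemma R1plus_le_idem A P : R1plus ip A -> adjoint ip P P ->
  (forall x, P (P x) = P x) -> (forall x, P (A x) = A x) -> op_le ip A P.
Proof.
move=> Ar Ps PP PA x; have As := R1plus_sym Ar; case: Ar => _ _ A01.
have -> : ip (A x) x = ip (A (P x)) (P x).
  by rewrite -[in LHS]PA Ps As -[in LHS]PA -Ps -As.
apply: (@le_trans _ _ (ip (P x) (P x))); first by case/andP: (A01 (P x)).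
by rewrite -Ps PP.
Qed.

(** From [P <= A <= I] and [P z = z], the positive operator [B = I - A] satisfies [<B z, z> = 0],
    which forces [B z = 0]. *)
Lemma R1plus_fix A P z : R1plus ip A -> op_le ip P A -> P z = z -> A z = z.
Proof.
move=> Ar PA Pz; have As := R1plus_sym Ar; case: Ar => Al _ A01.
pose B x := x - A x.
have Bl : linear B.
  by move=> a x y; rewrite /B Al scalerBr opprD addrACA.
have B0 x : 0 <= ip (B x) x.
  by rewrite /B (ipBl ipP) subr_ge0; case/andP: (A01 x).
have Bs := positive_sym Bl B0.
have Bz : ip (B z) z = 0.
  apply/eqP; rewrite eq_le B0 andbT /B (ipBl ipP) subr_le0.
  by have := PA z; rewrite Pz.
have Az : A z = z - B z by rewrite /B opprB addrC subrK.
clearbody B.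
pose b := sqnorm ip (B z); pose c := Re (ip (B (B z)) (B z)).
(* Positivity of [B] at [z - t B z]; there is no constant term since [<B z, z> = 0]. *)
have q (t : R) : 0 <= t ^+ 2 * c - 2 * t * b.
  have := B0 (z - t%:C *: B z); rewrite lecE => /andP[_].
  rewrite (linear_sub Bl) (linear_scale Bl) !(ipBl ipP) !(ipBr ipP).
  rewrite !(ipZl ipP) !(ipZr ipP) conjc_real Bz (Bs (B z) z) sub0r.
  rewrite !(ReD, ReN, ReZ) -/(sqnorm ip (B z)) -/b -/c /=.
  by congr (_ <= _); ring.
have b0 : b = 0.
  have b_ge0 : 0 <= b := sqnorm_ge0 ipP _.
  have c_ge0 : 0 <= c by have := B0 (B z); rewrite lecE => /andP[].
  apply/eqP; rewrite eq_le b_ge0 andbT leNgt; apply/negP => bp.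
  (* The near-minimizer [b / c], shifted to allow [c = 0], makes the quadratic negative when
     [b > 0]. *)
  have := q (b / (c + 1)).
  have c1 : 0 < c + 1 by lra.
  rewrite leNgt => /negP; apply.
  have -> : (b / (c + 1)) ^+ 2 * c - 2 * (b / (c + 1)) * b =
     - (b ^+ 2 * (c + 2)) / (c + 1) ^+ 2 by field; rewrite gt_eqF.
  rewrite mulNr oppr_lt0 divr_gt0 ?exprn_gt0 // mulr_gt0 ?exprn_gt0 //; lra.
by have /eqP := sqnorm_eq0 ipP b0; rewrite Az => /eqP ->; rewrite subr0.
Qed.

Lemma op_le_trans A B T : op_le ip A B -> op_le ip B T -> op_le ip A T.
Proof. by move=> AB BT x; exact: le_trans (AB x) (BT x). Qed.

Definition average N (A : 'I_N -> V -> V) (x : V) : V :=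
  (N%:R^-1)%:C *: \sum_(k < N) A k x.

Lemma ip_average N (A : 'I_N -> V -> V) x y :
  ip (average A x) y = (N%:R^-1)%:C * \sum_(k < N) ip (A k x) y.
Proof. by rewrite (ipZl ipP) (ip_suml ipP). Qed.

Lemma average_const_le N (c : R[i]) (F : 'I_N -> R[i]) : (0 < N)%N ->
  (forall k, c <= F k) -> c <= (N%:R^-1)%:C * \sum_(k < N) F k.
Proof.
move=> N0 cF; have N1 : (N%:R^-1)%:C * \sum_(k < N) c = c.
  rewrite sumr_const card_ord -[c *+ N]mulr_natl mulrA -(rmorph_nat (real_complex R)).
  by rewrite -rmorphM mulVf ?mul1r // pnatr_eq0 -lt0n.
rewrite -[leLHS]N1 ler_wpM2l ?ler_sum //.
by rewrite ler0c invr_ge0.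
Qed.

Lemma average_le_const N (c : R[i]) (F : 'I_N -> R[i]) : (0 < N)%N ->
  (forall k, F k <= c) -> (N%:R^-1)%:C * \sum_(k < N) F k <= c.
Proof.
move=> N0 Fc; rewrite -lerN2 -mulrN -sumrN; apply: average_const_le => // k.
by rewrite lerN2.
Qed.

Lemma linear_average N (A : 'I_N -> V -> V) : (forall k, linear (A k)) ->
  linear (average A).
Proof.
move=> Al a x y; rewrite /average; under eq_bigr do rewrite Al.
rewrite big_split /= -scaler_sumr scalerDr; congr (_ + _).
by rewrite !scalerA mulrC.
Qed.

Lemma R1plus_average N (A : 'I_N -> V -> V) : (0 < N)%N ->
  (forall k, R1plus ip (A k)) -> R1plus ip (average A).
Proof.
move=> N0 Ar; split.
- by apply: linear_average => k; case: (Ar k).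
- by apply/finite_rank_scale/finite_rank_sum => k; case: (Ar k).
move=> x; rewrite ip_average; apply/andP; split.
  by apply: average_const_le => // k; case: (Ar k) => _ _ /(_ x)/andP[].
by apply: average_le_const => // k; case: (Ar k) => _ _ /(_ x)/andP[].
Qed.

Lemma op_le_average N (A : 'I_N -> V -> V) B : (0 < N)%N ->
  (forall k, op_le ip B (A k)) -> op_le ip B (average A).
Proof.
by move=> N0 BA x; rewrite ip_average; apply: average_const_le => // k; exact: BA.
Qed.

Lemma commut_average N (A : 'I_N -> V -> V) n (T : 'I_n -> V -> V) i x :
  (forall i, linear (T i)) ->
  commut T (average A) i x = (N%:R^-1)%:C *: \sum_(k < N) commut T (A k) i x.
Proof.
move=> Tl; rewrite /commut /average (linear_scale (Tl i)) (linear_big (Tl i)).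
by rewrite -scalerBr -sumrB.
Qed.

Lemma adjoint_commut n (T T' : 'I_n -> V -> V) A i :
  (forall i, adjoint ip (T i) (T' i)) -> adjoint ip A A ->
  adjoint ip (commut T A i) (fun y => A (T' i y) - T' i (A y)).
Proof.
move=> TT' As x y.
by rewrite /commut (ipBl ipP) (ipBr ipP) TT' As As TT'.
Qed.

End Adjoints.

(** * Riesz representation and existence of adjoints *)

Section Riesz.
Variables (R : realType) (V : lmodType R[i]) (ip : V -> V -> R[i]).
Hypothesis ipP : is_inner_product ip.

Lemma invS_eventually_lt (e : R) : 0 < e ->
  exists N, forall n, (N <= n)%N -> n.+1%:R^-1 < e.
Proof.
move=> e0; exists (Num.bound e^-1) => n Nn.
rewrite invf_plt ?posrE //; apply: lt_le_trans (archi_boundP _) _.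
  by rewrite invr_ge0 ltW.
by rewrite ler_nat (leq_trans Nn).
Qed.

Lemma hnorm_lt x e : 0 < e -> (hnorm ip x < e) = (sqnorm ip x < e ^+ 2).
Proof.
by move=> e0; rewrite -(hnorm_sqr ipP) ltr_pXn2r ?nnegrE ?sqrtr_ge0 // ltW.
Qed.

(* [phi] is represented by the minimizer of [|x|^2 - 2 Re (phi x)]: by the
   parallelogram law every minimizing sequence is Cauchy. *)
Lemma riesz (phi : V -> R[i]) (K : R) : ip_complete ip ->
  (forall a x y, phi (a *: x + y) = a * phi x + phi y) ->
  0 <= K -> (forall x, nsq (phi x) <= K * sqnorm ip x) ->
  exists z, forall x, phi x = ip x z.
Proof.
move=> ipc phil K0 phib.
have phiD x y : phi (x + y) = phi x + phi y.
  by have := phil 1 x y; rewrite scale1r mul1r.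
have phi0 : phi 0 = 0 by apply: (addrI (phi 0)); rewrite -phiD !addr0.
have phiZ a x : phi (a *: x) = a * phi x.
  by have := phil a x 0; rewrite phi0 !addr0.
pose J x := sqnorm ip x - 2 * Re (phi x).
have J_lb x : - K <= J x.
  have X0 := sqnorm_ge0 ipP x; have := phib x; rewrite /J /nsq.
  move: (sqnorm ip x) X0 (Re _) (Im _) => X X0 r q rq.
  rewrite leNgt; apply/negP => lt1.
  have : (X + K) ^+ 2 < (2 * r) ^+ 2 by rewrite ltr_pXn2r // ?nnegrE; lra.
  by have := sqr_ge0 (X - K); have := sqr_ge0 q; nra.
pose S := range J.
have S_lb : has_lbound S by exists (- K) => _ [x _ <-].
have S_inf : has_inf S by split=> //; exists (J 0), 0.
have inf_le x : inf S <= J x by apply: ge_inf => //; exists x.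
have /choice[xs xsP] : forall n, exists x, J x < inf S + n.+1%:R^-1.
  move=> n.
  have n0 : 0 < n.+1%:R^-1 :> R by rewrite invr_gt0.
  have [_ [x _ <-] xlt] := inf_adherent n0 S_inf.
  by exists x.
have xs_close k l :
    sqnorm ip (xs k - xs l) <= 2 * (k.+1%:R^-1 + l.+1%:R^-1).
  have := inf_le ((2^-1)%:C *: (xs k + xs l)).
  have := xsP k; have := xsP l; rewrite /J (sqnormZ ipP) (sqnormD ipP).
  rewrite (sqnormB ipP) phiZ phiD ReZ ReD.
  have -> : nsq (2^-1 : R)%:C = 4^-1 by rewrite /nsq /= expr0n addr0; field.
  move: (inf S) (k.+1%:R^-1) (l.+1%:R^-1) (Re _) (Re _) (Re _) => i a b r pk pl.
  by move: (sqnorm _ _) (sqnorm _ _) => X Y; lra.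
have [z zP] : exists z, forall e, 0 < e -> exists N, forall k, (N <= k)%N ->
    hnorm ip (xs k - z) < e.
  apply: ipc => e e0.
  have /invS_eventually_lt[N NP] : 0 < e ^+ 2 / 4 by rewrite divr_gt0 // exprn_gt0.
  exists N => k l Nk Nl; rewrite hnorm_lt //.
  have := xs_close k l; have := NP k Nk; have := NP l Nl.
  by move: (k.+1%:R^-1) (l.+1%:R^-1) (sqnorm _ _) => a b X; lra.
have Re_eq h : Re (phi h) = Re (ip h z).
  rewrite (ipC ipP z h) ReJ.
  pose H := sqnorm ip h; have H0 : 0 <= H := sqnorm_ge0 ipP h.
  pose del := Re (ip z h) - Re (phi h).
  have del_small eta : 0 < eta -> del ^+ 2 <= 4 * (H + 1) * eta.
    move=> eta0; have [N1 N1P] := invS_eventually_lt eta0.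
    have /zP[N2 N2P] : 0 < Num.sqrt eta by rewrite sqrtr_gt0.
    pose n := maxn N1 N2; have nN1 := N1P n (leq_maxl _ _).
    have := N2P n (leq_maxr _ _); rewrite hnorm_lt ?sqrtr_gt0 // (sqr_sqrtr (ltW eta0)) => nN2.
    pose dn := Re (ip (xs n) h) - Re (phi h).
    have dn_small : dn ^+ 2 <= (H + 1) * eta.
      (* Moving the almost minimal [xs n] by [t h] cannot lower [J] much. This [t] minimizes
         [t^2 (H + 1) + 2 t dn], where [H + 1] replaces [H] to avoid dividing by zero. *)
      pose t := - dn / (H + 1).
      have := inf_le (xs n + t%:C *: h); have := xsP n.
      rewrite /J (sqnormD ipP) (sqnormZ ipP) phiD phiZ (ipZr ipP) conjc_real !(ReD, ReZ).
      have -> : nsq t%:C = t ^+ 2 by rewrite /nsq /= expr0n addr0.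
      rewrite -/H => lt1 le1.
      have H1 : H + 1 != 0 by rewrite gt_eqF // ltr_wpDl.
      have le2 : - n.+1%:R^-1 <= t ^+ 2 * (H + 1) + 2 * t * dn.
        have := sqr_ge0 t; move: lt1 le1; rewrite /dn; move: (n.+1%:R^-1) => a; lra.
      have tE : t ^+ 2 * (H + 1) + 2 * t * dn = - (dn ^+ 2 / (H + 1)).
        by rewrite /t; field.
      rewrite mulrC -ler_pdivrMr ?ltr_wpDl //.
      by move: le2 nN1; rewrite tE; move: (n.+1%:R^-1) => a; lra.
    have dz : Re (ip (xs n - z) h) ^+ 2 <= eta * H.
      have := cauchy_schwarz ipP (xs n - z) h; rewrite -/H /nsq.
      have := sqr_ge0 (Im (ip (xs n - z) h)); nra.
    have -> : del = dn - Re (ip (xs n - z) h).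
      by rewrite /del /dn (ipBl ipP) ReD ReN; ring.
    move: (Re (ip (xs n - z) h)) dz dn_small => r dz dn_small.
    have := sqr_ge0 (dn + r); nra.
  suff : del = 0 by rewrite /del => /eqP; rewrite subr_eq0 => /eqP ->.
  apply/eqP; rewrite -sqrf_eq0 eq_le sqr_ge0 andbT leNgt; apply/negP => d0.
  have H1 : 0 < H + 1 by rewrite ltr_wpDl.
  (* With this [eta] the bound becomes [del^2 <= del^2 / 2]. *)
  have eta0 : 0 < del ^+ 2 / (8 * (H + 1)) by apply: divr_gt0 => //; exact: mulr_gt0.
  have := del_small _ eta0.
  have -> : 4 * (H + 1) * (del ^+ 2 / (8 * (H + 1))) = del ^+ 2 / 2.
    by field; rewrite gt_eqF.
  lra.
exists z => x.
(* Imaginary parts are the real parts at [- i x]. *)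
have := Re_eq (- 'i%C *: x); have := Re_eq x.
rewrite phiZ (ipZl ipP).
by case: (phi x) (ip x z) => [a b] [c d] /= -> e; congr (_ +i* _); lra.
Qed.

Lemma bounded_op_sqnorm T M : (forall x, hnorm ip (T x) <= M * hnorm ip x) ->
  forall x, sqnorm ip (T x) <= M ^+ 2 * sqnorm ip x.
Proof.
move=> TM x; rewrite -!(hnorm_sqr ipP) -exprMn ler_pXn2r ?nnegrE ?sqrtr_ge0 //.
by apply: le_trans (TM x); rewrite sqrtr_ge0.
Qed.

Lemma adjoint_exists T : ip_complete ip -> linear T -> bounded_op ip T ->
  exists T', adjoint ip T T'.
Proof.
move=> ipc Tl [M TM].
suff : forall y, exists z, forall x, ip (T x) y = ip x z.
  by move=> /choice[T' TT']; exists T' => x y; rewrite TT'.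
move=> y; apply: (@riesz (fun x => ip (T x) y) (M ^+ 2 * sqnorm ip y)) => //.
- by move=> a x x'; rewrite Tl (ipDl ipP) (ipZl ipP).
- by rewrite mulr_ge0 ?sqr_ge0 ?sqnorm_ge0.
move=> x; apply: (le_trans (cauchy_schwarz ipP _ _)).
rewrite mulrAC ler_wpM2r ?sqnorm_ge0 //.
exact: bounded_op_sqnorm.
Qed.

End Riesz.

(** * Tensoring with C^m *)

Section SumBlocks.
Variables (m : nat) (m_gt0 : (0 < m)%N).

Definition block_pos (j : nat) : 'I_m := Ordinal (ltn_pmod j m_gt0).

(** Division with remainder by [m] splits a sum of length [d * m] into [d] blocks of length [m]. *)
Lemma sum_blocks (M : nmodType) d (F : nat -> 'I_m -> M) :
  \sum_(j < d * m) F (j %/ m)%N (block_pos j) = \sum_(l < d) \sum_(i < m) F l i.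
Proof.
elim: d => [|d IH]; first by rewrite !big_ord0.
rewrite mulSnr big_split_ord big_ord_recr /= -IH; congr (_ + _).
apply: eq_bigr => i _; congr F.
  by rewrite divnMDl // divn_small // addn0.
by apply: val_inj; rewrite /= modnMDl modn_small.
Qed.

End SumBlocks.

Section TensorSpace.
Variables (R : realType) (V : lmodType R[i]) (ip : V -> V -> R[i]).
Hypothesis ipP : is_inner_product ip.
Variables (m : nat) (m_gt0 : (0 < m)%N).
Local Notation tip := (tens_ip ip (m:=m)).
Local Notation top := (@tens_op R V m).
Local Notation W := {ffun 'I_m -> V}.

Lemma tens_ip_inner_product : is_inner_product tip.
Proof.
split; [|split; [|split]].
- move=> a x y z; rewrite /tens_ip mulr_sumr -big_split; apply: eq_bigr => i _.
  by rewrite !ffunE (ipDl ipP) (ipZl ipP).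
- move=> x y; rewrite /tens_ip rmorph_sum; apply: eq_bigr => i _; exact: (ipC ipP).
- by move=> x; apply: sumr_ge0 => i _; rewrite (ipxx ipP) ler0c sqnorm_ge0.
move=> x x0; apply/ffunP => i; rewrite ffunE; apply/(sqnorm_eq0 ipP)/eqP.
have : \sum_(i < m) sqnorm ip (x i) = 0.
  by apply: complexI; rewrite -[RHS]x0 rmorph_sum; apply: eq_bigr => k _; rewrite (ipxx ipP).
move=> /eqP; rewrite psumr_eq0 => [/allP/(_ i)|k _]; last exact: sqnorm_ge0.
by rewrite mem_index_enum; apply.
Qed.

(** The elementary tensor of [x] with the [k]-th basis vector of [C^m]. *)
Definition tens_vec (k : 'I_m) (x : V) : W := [ffun i => if i == k then x else 0].

Lemma tens_vec_linear k : linear (tens_vec k).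
Proof.
move=> a x y; apply/ffunP => i; rewrite !ffunE; case: ifP => // _.
by rewrite scaler0 addr0.
Qed.

Lemma tens_ip_vecr g k y : tip g (tens_vec k y) = ip (g k) y.
Proof.
rewrite /tens_ip (bigD1 k) //= big1 ?addr0 ?ffunE ?eqxx // => i ik.
by rewrite ffunE (negPf ik) (ip0r ipP).
Qed.

Lemma tens_op_linear T : linear T -> linear (top T).
Proof. by move=> Tl a x y; apply/ffunP => i; rewrite !ffunE Tl. Qed.

Lemma tens_op_vec T k x : linear T -> top T (tens_vec k x) = tens_vec k (T x).
Proof.
move=> Tl; apply/ffunP => i; rewrite !ffunE; case: ifP => // _.
exact: linear_zero Tl.
Qed.

Lemma tens_op_adjoint T T' : adjoint ip T T' ->
  adjoint tip (top T) (top T').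
Proof. by move=> TT' x y; apply: eq_bigr => i _; rewrite !ffunE TT'. Qed.

Lemma tens_op_R1plus A : R1plus ip A -> R1plus tip (top A).
Proof.
move=> [Al Af A01]; split; first exact: tens_op_linear.
- have -> : top A = fun g : W => \sum_(k < m) tens_vec k (A (g k)).
    apply/funext => g; apply/ffunP => i; rewrite !ffunE sum_ffunE (bigD1 i) //=.
    rewrite big1 => [|k ki]; first by rewrite addr0 ffunE eqxx.
    by rewrite ffunE eq_sym (negPf ki).
  apply: finite_rank_sum => k.
  exact: (finite_rank_compl (fun g : W => g k) (tens_vec_linear k) Af).
move=> g; apply/andP; split.
  by apply: sumr_ge0 => i _; rewrite ffunE; case/andP: (A01 (g i)).
by apply: ler_sum => i _; rewrite ffunE; case/andP: (A01 (g i)).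
Qed.

Lemma tens_op_le A B : op_le ip A B -> op_le tip (top A) (top B).
Proof. by move=> AB g; apply: ler_sum => i _; rewrite !ffunE; exact: AB. Qed.

Definition diag_block (B : W -> W) (k : 'I_m) (x : V) : V := B (tens_vec k x) k.

Lemma ip_diag_block B k x y :
  ip (diag_block B k x) y = tip (B (tens_vec k x)) (tens_vec k y).
Proof. by rewrite tens_ip_vecr. Qed.

Lemma diag_block_linear B k : linear B -> linear (diag_block B k).
Proof.
by move=> Bl a x y; rewrite /diag_block tens_vec_linear Bl !ffunE.
Qed.

Lemma diag_block_R1plus B k : R1plus tip B -> R1plus ip (diag_block B k).
Proof.
move=> [Bl Bf B01]; split; first exact: diag_block_linear.
  have pl : linear (fun g : W => g k) by move=> a x y; rewrite !ffunE.
  exact: (finite_rank_compl (tens_vec k) pl Bf).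
move=> x; rewrite ip_diag_block.
by have := B01 (tens_vec k x); rewrite [tip (tens_vec _ _) _]tens_ip_vecr ffunE eqxx.
Qed.

Lemma diag_block_le A B k : linear A -> op_le tip (top A) B ->
  op_le ip A (diag_block B k).
Proof.
move=> Al AB x; rewrite ip_diag_block; apply: le_trans (AB _).
by rewrite tens_op_vec // tens_ip_vecr ffunE eqxx.
Qed.

Lemma commut_tens_op n (T : 'I_n -> V -> V) A i :
  commut (fun i => top (T i)) (top A) i = top (commut T A i).
Proof. by apply/funext => g; apply/ffunP => k; rewrite !ffunE. Qed.

(** Since the amplified [T i] is block diagonal, compressing to a diagonal block commutes with
    taking commutators. *)
Lemma commut_diag_block n (T : 'I_n -> V -> V) B i k x : linear (T i) ->
  commut T (diag_block B k) i x =
  diag_block (commut (fun i => top (T i)) B i) k x.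
Proof.
by move=> Tl; rewrite /commut /diag_block tens_op_vec // !ffunE.
Qed.

(** The position in [C^m] varies fastest: each [u l] fills [m] consecutive indices, so repeated
    singular values stay in decreasing order. *)
Definition tens_family (u : nat -> V) (j : nat) : W :=
  tens_vec (block_pos m_gt0 j) (u (j %/ m)%N).

Lemma tens_family_ip u i j : tip (tens_family u i) (tens_family u j) =
  if block_pos m_gt0 i == block_pos m_gt0 j
  then ip (u (i %/ m)%N) (u (j %/ m)%N) else 0.
Proof.
by rewrite tens_ip_vecr ffunE eq_sym; case: ifP; rewrite ?(ip0l ipP).
Qed.

Lemma block_eq i j : (i == j) =
  (block_pos m_gt0 i == block_pos m_gt0 j) && ((i %/ m)%N == (j %/ m)%N).
Proof.
apply/eqP/andP => [->//|[/eqP/(congr1 val)/= ij /eqP dij]].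
by rewrite (divn_eq i m) (divn_eq j m) ij dij.
Qed.

Lemma tens_family_orthonormal d u : orthonormal ip d u ->
  orthonormal tip (d * m) (tens_family u).
Proof.
move=> uo i j id jd; rewrite tens_family_ip block_eq.
by case: ifP => //= _; rewrite uo // ltn_divLR.
Qed.

Lemma tens_family_subon u : subon ip u -> subon tip (tens_family u).
Proof.
move=> [uo u1]; split=> [i j|i].
  rewrite block_eq negb_and tens_family_ip.
  by case: ifP => //= _; exact: uo.
by rewrite /sqnorm tens_family_ip eqxx; exact: u1.
Qed.

Lemma svd_tens_op T d s u v : svd ip T d s u v ->
  svd tip (top T) (d * m) (fun j => s (j %/ m)%N) (tens_family u) (tens_family v).
Proof.
move=> [s0 s_dec uo vo TE]; split.
- by move=> l; have [sl sl'] := s0 (l %/ m)%N; rewrite sl' ltn_divLR.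
- by move=> j k jk; apply: s_dec; rewrite leq_div2r.
- exact: tens_family_orthonormal.
- exact: tens_family_orthonormal.
move=> g; rewrite (sum_blocks m_gt0 d (fun l i =>
  ((s l)%:C * tip g (tens_vec i (u l))) *: tens_vec i (v l))).
apply/ffunP => k; rewrite ffunE TE sum_ffunE; apply: eq_bigr => l _.
rewrite sum_ffunE (bigD1 k) //= big1 ?addr0 => [|i ik].
  by rewrite !ffunE eqxx tens_ip_vecr.
by rewrite !ffunE eq_sym (negPf ik) scaler0.
Qed.

Lemma lorentz_le_of_diag_blocks (p : \bar R) D C d s u v d' s' u' v' : (1 <= p)%E ->
  svd ip D d s u v -> svd tip C d' s' u' v' ->
  (forall x, D x = average (diag_block C) x) ->
  powR m%:R (invp p) * \sum_(l < d) lorentz_weight p l * s l <=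
  \sum_(l < d') lorentz_weight p l * s' l.
Proof.
move=> p1 Ds Cs DE; have [_ _ uo vo _] := Ds.
(* The Lorentz weight frozen at the last index of each block: still decreasing, below the true
   weight, and of block sum [m^(1/p) w_l] by [lorentz_weight_block]. *)
pose w j := lorentz_weight p ((j %/ m).+1 * m).-1.
have w_le j : w j <= lorentz_weight p j.
  apply: lorentz_weight_decr => //.
  by rewrite -ltnS prednK ?muln_gt0 // ltn_ceil.
have w_dec j k : (j <= k)%N -> w k <= w j.
  move=> jk; apply: lorentz_weight_decr => //.
  by rewrite -!subn1 leq_sub2r // leq_mul2r ltnS leq_div2r ?orbT.
have := ky_fan_weighted tens_ip_inner_product Cs (d * m)
  (fun j => lorentz_weight_ge0 p _) w_dec
  (tens_family_subon (subon_truncate ipP uo))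
  (tens_family_subon (subon_truncate ipP vo)).
rewrite (sum_blocks m_gt0 d (fun l i => lorentz_weight p (l.+1 * m).-1 *
  Re (tip (C (tens_vec i (truncate d u l))) (tens_vec i (truncate d v l))))).
move=> le1; apply: (@le_trans _ _ (\sum_(l < d') w l * s' l)); last first.
  by apply: ler_sum => l _; rewrite ler_wpM2r ?(svd_ge0 Cs).
apply: le_trans le1; rewrite mulr_sumr le_eqVlt; apply/orP; left; apply/eqP.
apply: eq_bigr => l _; rewrite mulrA -lorentz_weight_block // -mulr_sumr.
rewrite mulrAC mulrC; congr (_ * _).
have -> : s l = Re (ip (D (truncate d u l)) (truncate d v l)).
  rewrite /truncate ltn_ord (svd_image_basis Ds) // (ipZl ipP) vo // eqxx.
  by rewrite mulr1.
rewrite DE (ip_average ipP) ReZ Re_sum mulrA divff ?mul1r; last first.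
  by rewrite pnatr_eq0 -lt0n.
by apply: eq_bigr => i _; rewrite ip_diag_block.
Qed.

Lemma lorentz_tens_op_le (p : \bar R) d (s : nat -> R) : (1 <= p)%E ->
  (forall l, 0 <= s l) -> (forall j k, (j <= k)%N -> s k <= s j) ->
  \sum_(j < d * m) lorentz_weight p j * s (j %/ m)%N <=
  powR m%:R (invp p) * (\sum_(l < d) lorentz_weight p l * s l) + m%:R * s 0%N.
Proof.
move=> p1 s0 s_dec; pose w := lorentz_weight p.
have w_dec j k : (j <= k)%N -> w k <= w j by exact: lorentz_weight_decr.
have w_ge0 j : 0 <= w j := lorentz_weight_ge0 p j.
rewrite (eq_bigr (fun j : 'I_(d * m) =>
    w ((j %/ m) * m + block_pos m_gt0 j)%N * s (j %/ m)%N)); last first.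
  by move=> j _; rewrite /= -divn_eq.
rewrite (sum_blocks m_gt0 d (fun l i => w (l * m + i)%N * s l)).
(* All weights of a block are bounded by its first one. Passing to the last one, which gives the
   exact factor [m^(1/p)], costs at most the drop of [w] to the start of the next block; these drops
   telescope to at most [w 0 = 1]. *)
have blockw (l : 'I_d) : \sum_(i < m) w (l * m + i)%N * s l <=
    powR m%:R (invp p) * (w l * s l) + s 0%N * (m%:R * (w (l * m)%N - w (l.+1 * m)%N)).
  rewrite -mulr_suml mulrA -lorentz_weight_block //.
  apply: (@le_trans _ _ ((m%:R * w (l * m)%N) * s l)).
    rewrite ler_wpM2r // mulr_natl -[X in _ *+ X]card_ord -sumr_const.
    by apply: ler_sum => i _; rewrite w_dec ?leq_addr.
  have le1 : w (l.+1 * m)%N <= w (l.+1 * m).-1 by rewrite w_dec // leq_pred.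
  have le2 : w (l.+1 * m)%N <= w (l * m)%N by rewrite w_dec // leq_mul2r leqnSn orbT.
  have := s_dec 0%N l (leq0n _); have := s0 l.
  have m0 : 0 <= m%:R :> R by [].
  rewrite -/w; move: le1 le2 m0.
  move: (w (l.+1 * m).-1) (w (l * m)%N) (w (l.+1 * m)%N) (s l) (s 0%N) m%:R.
  move=> b a c sl s0' m' cb ca m'0 sl0 sls0.
  rewrite -subr_ge0.
  have -> : m' * b * sl + s0' * (m' * (a - c)) - m' * a * sl =
      m' * (sl * (b - c) + (s0' - sl) * (a - c)) by ring.
  by rewrite mulr_ge0 // addr_ge0 // mulr_ge0 // subr_ge0.
have telescope : \sum_(l < d) (w (l * m)%N - w (l.+1 * m)%N) = 1 - w (d * m)%N.
  elim: d {blockw} => [|d IH]; first by rewrite big_ord0 /w lorentz_weight0 subrr.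
  by rewrite big_ord_recr /= IH; ring.
apply: (le_trans (ler_sum _ (fun l _ => blockw l))).
rewrite big_split /= -!mulr_sumr lerD2l mulrC ler_wpM2r // ler_piMr //.
by rewrite telescope gerBl.
Qed.

End TensorSpace.

(** * Small commutators *)

Section SmallCommutators.
Variables (R : realType) (V : lmodType R[i]) (ip : V -> V -> R[i]).
Hypothesis ipP : is_inner_product ip.
Variables (n : nat) (T T' : 'I_n -> V -> V).
Hypothesis T_lin : forall i, linear (T i).
Hypothesis T_adj : forall i, adjoint ip (T i) (T' i).
Implicit Types (A B : V -> V).

Lemma adjoint_linear (S S' : V -> V) : adjoint ip S S' -> linear S'.
Proof.
move=> SS' a x y; apply: (ip_sep ipP) => z.
rewrite (ipDl ipP) (ipZl ipP) ![ip _ z](ipC ipP z) -!SS' (ipDr ipP) (ipZr ipP).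
by rewrite rmorphD /= conjcM conjcK.
Qed.

(** Positivity of [A] at [x - A x] and [A <= I] at [A x] give [|A x|^2 <= <A x, x>], which is at
    most [|x|^2]. *)
Lemma R1plus_sqnorm_le A x : R1plus ip A -> sqnorm ip (A x) <= sqnorm ip x.
Proof.
move=> Ar; have As := R1plus_sym ipP Ar; have [Al _ A01] := Ar.
have /andP[_] := A01 x; rewrite lecE => /andP[_ le1].
have /andP[+ _] := A01 (x - A x); rewrite lecE => /andP[_].
have /andP[_] := A01 (A x); rewrite lecE => /andP[_].
rewrite (linear_sub Al) !(ipBl ipP) !(ipBr ipP) (As (A x) x).
rewrite !(ReD, ReN) /=; move: le1.
by rewrite -/(sqnorm ip x) -/(sqnorm ip (A x)) /=; lra.
Qed.

Lemma commut_svd A i : R1plus ip A -> exists d s u v, svd ip (commut T A i) d s u v.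
Proof.
move=> Ar; apply: (svd_exists ipP (finite_rank_commut i T_lin _)).
  by case: Ar.
exact: (adjoint_commut ipP i T_adj (R1plus_sym ipP Ar)).
Qed.

Lemma sqnorm_sum_orthogonal N (F : 'I_N -> V) :
  (forall j k : 'I_N, (j < k)%N -> ip (F k) (F j) = 0) ->
  sqnorm ip (\sum_(k < N) F k) = \sum_(k < N) sqnorm ip (F k).
Proof.
move=> F_orth; rewrite /sqnorm (ip_suml ipP) Re_sum; apply: eq_bigr => k _.
rewrite (ip_sumr ipP) (bigD1 k) //= big1 ?addr0 // => j jk.
have [jk'|kj|/val_inj jk'] := ltngtP j k; first exact: F_orth.
  by rewrite (ipC ipP) F_orth ?conjc0.
by rewrite jk' eqxx in jk.
Qed.

Lemma finite_rank_common_projection (I : finType) (F : I -> V -> V) :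
  (forall i, finite_rank (F i)) -> exists d f,
  orthonormal ip d f /\ forall i x, onproj ip d f (F i x) = F i x.
Proof.
move=> F_fr; have /choice[vs vsP] i := finite_rank_fixed ipP (F_fr i).
have [d [f [fo fvs]]] := gram_schmidt ipP (flatten [seq vs i | i <- enum I]).
exists d, f; split=> // i x; apply: vsP => v v_vs; apply: fvs.
by apply/flatten_mapP; exists i; rewrite ?mem_enum.
Qed.

(** The clauses ensure that [A'] fixes the ranges of [[T_i, A]] and of [T'_i [T_i, A]], as needed
    for orthogonality of later commutators. *)
Definition dominates A A' :=
  [/\ forall x, A' (A x) = A x,
      forall i x, A' (T i (A x)) = T i (A x),
      forall i x, A' (T' i (A x)) = T' i (A x) &
      forall i x, A' (T' i (T i (A x))) = T' i (T i (A x))].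

Variables (p : \bar R) (alpha : R).
Hypothesis p_ge1 : (1 <= p)%E.
Hypothesis alpha_ge0 : 0 <= alpha.
Hypothesis cofinal : forall A0, R1plus ip A0 -> exists A,
  [/\ R1plus ip A, op_le ip A0 A & (tuple_lorentz ip p (commut T A) <= alpha%:E)%E].

Lemma dominating_step A0 A : R1plus ip A0 -> R1plus ip A -> exists A',
  [/\ R1plus ip A', op_le ip A0 A',
      (tuple_lorentz ip p (commut T A') <= alpha%:E)%E & dominates A A'].
Proof.
move=> A0r Ar; have Af : finite_rank A by case: Ar.
have T'_lin i := adjoint_linear (T_adj i).
(* All ranges that [A'] must fix, collected so that a single projection covers them. An [A'] above
   that projection fixes them by [R1plus_fix]. *)
pose F (j : bool + ('I_n + 'I_n + 'I_n)) : V -> V := match j with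
  | inl b => if b then A0 else A
  | inr (inl (inl i)) => T i \o A
  | inr (inl (inr i)) => T' i \o A
  | inr (inr i) => T' i \o (T i \o A) end.
have F_fr j : finite_rank (F j).
  case: j => [[]|[[i|i]|i]] //=; first by case: A0r.
  - exact: (finite_rank_compl id (T_lin i) Af).
  - exact: (finite_rank_compl id (T'_lin i) Af).
  apply: (finite_rank_compl id (T'_lin i)).
  exact: (finite_rank_compl id (T_lin i) Af).
have [d [f [fo Ff]]] := finite_rank_common_projection F_fr.
have [A' [A'r PA' A't]] := cofinal (onproj_R1plus ipP fo).
have fixA' j x : A' (F j x) = F j x by exact: (R1plus_fix ipP A'r PA').
exists A'; split=> //.
  apply: (op_le_trans _ PA'); apply: (R1plus_le_idem ipP A0r).
  - exact: (onproj_sym ipP).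
  - by move=> x; exact: (onproj_idem ipP).
  - exact: (Ff (inl true)).
split.
- exact: (fixA' (inl false)).
- by move=> i; exact: (fixA' (inr (inl (inl i)))).
- by move=> i; exact: (fixA' (inr (inl (inr i)))).
- by move=> i; exact: (fixA' (inr (inr i))).
Qed.

(* The commutators with a rapidly increasing sequence have mutually orthogonal
   ranges, so their average over [N] terms has norm [O(1 / sqrt N)]. *)
Lemma small_commutators A0 (M : 'I_n -> R) (eps : R) : R1plus ip A0 ->
  (forall i x, sqnorm ip (T i x) <= M i ^+ 2 * sqnorm ip x) -> 0 < eps ->
  exists A, [/\ R1plus ip A, op_le ip A0 A,
    (tuple_lorentz ip p (commut T A) <= alpha%:E)%E &
    forall i x, sqnorm ip (commut T A i x) <= eps ^+ 2 * sqnorm ip x].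
Proof.
move=> A0r TM eps0.
have /choice[F FP] A : exists A', R1plus ip A ->
    [/\ R1plus ip A', op_le ip A0 A',
      (tuple_lorentz ip p (commut T A') <= alpha%:E)%E & dominates A A'].
  have [Ar|] := pselect (R1plus ip A); last by exists A.
  by have [A' A'P] := dominating_step A0r Ar; exists A'.
(* The sequence below starts at the first iterate, because [A0] itself need not satisfy the bound by
   [alpha]. *)
have iterP k : R1plus ip (iter k F A0) by elim: k => // k IH; case: (FP _ IH).
pose a k := iter k.+1 F A0.
have aP k : [/\ R1plus ip (a k), op_le ip A0 (a k) &
    (tuple_lorentz ip p (commut T (a k)) <= alpha%:E)%E].
  by have [] := FP _ (iterP k).
have a_dom k : dominates (a k) (a k.+1) by case: (FP _ (iterP k.+1)).
have a_fix j k z : (j <= k)%N -> a j z = z -> a k z = z.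
  move=> + jz; elim: k => [|k IH]; first by rewrite leqn0 => /eqP <-.
  rewrite leq_eqVlt => /predU1P[<- //|/IH kz].
  by have [/(_ z)] := a_dom k; rewrite kz.
pose D i k x := commut T (a k) i x.
(* With [z] in the range of the earlier commutator, [a k] fixes [z] and [T' i z], so both terms of
   [<D i k x, z>] equal [<x, T' i z>] and cancel. *)
have D_orth i j k x y : (j < k)%N -> ip (D i k x) (D i j y) = 0.
  move=> jk; have [f1 f2 f3 f4] := a_dom j.
  have fixk z : a j.+1 z = z -> a k z = z by exact: a_fix.
  have ak_sub : {morph a k : u v / u - v}.
    by have [[akl _ _] _ _] := aP k; exact: (linear_sub akl).
  have T'_lin := adjoint_linear (T_adj i).
  set z := D i j y.
  have kz : a k z = z.
    by rewrite /z /D /commut ak_sub !fixk.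
  have kT'z : a k (T' i z) = T' i z.
    by rewrite /z /D /commut (linear_sub T'_lin) ak_sub !fixk.
  have as_ := R1plus_sym ipP (let: And3 r _ _ := aP k in r).
  by rewrite /D /commut (ipBl ipP) T_adj !as_ kz kT'z T_adj subrr.
(* From [|a - b|^2 <= 2 |a|^2 + 2 |b|^2], each term being bounded by [M_i^2 |x|^2]. *)
have D_norm i k x : sqnorm ip (D i k x) <= 4 * M i ^+ 2 * sqnorm ip x.
  have [ar _ _] := aP k.
  have := sqnorm_ge0 ipP (T i (a k x) + a k (T i x)).
  rewrite /D /commut (sqnormD ipP) (sqnormB ipP).
  have := R1plus_sqnorm_le x ar; have := R1plus_sqnorm_le (T i x) ar.
  have := TM i x; have := TM i (a k x).
  have := sqr_ge0 (M i); move: (M i ^+ 2) (Re _) => m2 r; nra.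
pose K := \sum_i 4 * M i ^+ 2.
have K_ge i : 4 * M i ^+ 2 <= K.
  rewrite /K (bigD1 i) //= lerDl; apply: sumr_ge0 => j _.
  by rewrite mulr_ge0 ?sqr_ge0.
have eps2 : 0 < eps ^+ 2 by rewrite exprn_gt0.
pose N := (Num.bound (K / eps ^+ 2)).+1.
have KN : K <= N%:R * eps ^+ 2.
  rewrite -ler_pdivrMr //; apply: (@le_trans _ _ (Num.bound (K / eps ^+ 2))%:R).
    apply/ltW/archi_boundP/divr_ge0; last exact: ltW.
    by apply: sumr_ge0 => j _; rewrite mulr_ge0 ?sqr_ge0.
  by rewrite ler_nat.
exists (average (fun k : 'I_N => a k)).
have Nr : R1plus ip (average (fun k : 'I_N => a k)).
  by apply: (R1plus_average ipP) => // k; case: (aP k).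
split=> //.
- by apply: (op_le_average ipP) => // k; case: (aP k).
- apply: bigmax_le => [|i _]; first by rewrite lee_fin.
  have [d [s [u [v Ds]]]] := commut_svd i Nr.
  rewrite (svd_lorentz_norm ipP p Ds) lee_fin.
  apply: (svd_average_le ipP (N := N) (D := fun k => D i k) _ _ _ Ds) => //.
  + by move=> j; exact: lorentz_weight_ge0.
  + by move=> j k; exact: lorentz_weight_decr.
  + by move=> x; exact: commut_average.
  move=> k; have [ar _ at_] := aP k.
  have [d' [s' [u' [v' Ds']]]] := commut_svd i ar.
  exists d', s', u', v'; split=> //.
  rewrite -lee_fin -(svd_lorentz_norm ipP p Ds'); apply: le_trans at_.
  exact: (le_bigmax _ (fun i => lorentz_norm ip p (commut T (a k) i))).
move=> i x; rewrite commut_average // (sqnormZ ipP).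
(* Orthogonality bounds the squared norm of the average by [N^-2 * N K |x|^2], and [N] was chosen
   with [K / N <= eps^2]. *)
rewrite (@sqnorm_sum_orthogonal N (fun k => D i k x)) => [|j k jk]; last exact: D_orth.
have -> : nsq (N%:R^-1 : R)%:C = N%:R^-1 ^+ 2 by rewrite /nsq /= expr0n addr0.
have N0 : 0 < N%:R :> R by rewrite ltr0n.
rewrite exprVn mulrC ler_pdivrMr ?exprn_gt0 //.
apply: (@le_trans _ _ (\sum_(k < N) K * sqnorm ip x)).
  apply: ler_sum => k _; apply: le_trans (D_norm i k x) _.
  by rewrite ler_wpM2r ?sqnorm_ge0.
rewrite sumr_const card_ord -[_ *+ N]mulr_natl expr2.
have := sqnorm_ge0 ipP x; move: (sqnorm ip x) => X X0.
have -> : eps ^+ 2 * X * (N%:R * N%:R) = N%:R * (N%:R * eps ^+ 2 * X) by ring.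
by rewrite (ler_wpM2l (ltW N0)) // ler_wpM2r.
Qed.

End SmallCommutators.

(** * The quasicentral modulus *)

Lemma lorentz_norm_ge0 (R : realType) (V : lmodType R[i]) (ip : V -> V -> R[i])
    (p : \bar R) T d s u v :
  is_inner_product ip -> svd ip T d s u v -> (0 <= lorentz_norm ip p T)%E.
Proof.
move=> ipP Ts; rewrite (svd_lorentz_norm ipP p Ts) lee_fin.
by apply: sumr_ge0 => j _; rewrite mulr_ge0 ?lorentz_weight_ge0 ?(svd_ge0 Ts).
Qed.

Lemma R1plus_zero (R : realType) (V : lmodType R[i]) (ip : V -> V -> R[i]) :
  is_inner_product ip -> R1plus ip (fun=> 0).
Proof.
move=> ipP; split=> [a x y| |x].
- by rewrite scaler0 addr0.
- exact: finite_rank_zero.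
- by rewrite (ip0l ipP) lexx /= (ipxx ipP) ler0c sqnorm_ge0.
Qed.

Section TensorModulus.
Variables (R : realType) (V : lmodType R[i]) (ip : V -> V -> R[i]).
Hypothesis ipP : is_inner_product ip.
Variables (n : nat) (T T' : 'I_n -> V -> V) (M : 'I_n -> R).
Hypothesis T_lin : forall i, linear (T i).
Hypothesis T_adj : forall i, adjoint ip (T i) (T' i).
Hypothesis T_bd : forall i x, sqnorm ip (T i x) <= M i ^+ 2 * sqnorm ip x.
Variables (p : \bar R) (m : nat).
Hypothesis p_ge1 : (1 <= p)%E.
Hypothesis m_gt0 : (0 < m)%N.
Local Notation tip := (tens_ip ip (m:=m)).
Local Notation top := (@tens_op R V m).
Local Notation c := (powR m%:R (invp p)).

Let c_gt0 : 0 < c :> R.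
Proof. by rewrite powR_gt0 // ltr0n. Qed.

Lemma qc_modulus_tens_ge :
  (c%:E * qc_modulus ip p T <= qc_modulus tip p (fun i => top (T i)))%E.
Proof.
have tipP := tens_ip_inner_product ipP m.
rewrite -lee_pdivlMl //; apply: ge_ereal_sup => _ [A0 A0r <-].
rewrite lee_pdivlMl //; apply: le_ereal_sup_tmp.
(* The supremum on the tensor side is tested at the amplification of [A0]. *)
eexists; first by exists (top A0); [exact: tens_op_R1plus|reflexivity].
apply: le_ereal_inf_tmp => _ [B [Br A0B] <-].
have A0l : linear A0 by case: A0r.
rewrite -lee_pdivlMl //; apply: ge_ereal_inf.
pose A := average (diag_block (V := V) B).
have Ar : R1plus ip A.
  by apply: (R1plus_average ipP) => // k; exact: diag_block_R1plus.
exists (tuple_lorentz ip p (commut T A)).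
  exists A => //; split=> //.
  by apply: (op_le_average ipP) => // k; exact: diag_block_le.
have comm_svd i : exists d s u v, svd tip (commut (fun i => top (T i)) B i) d s u v.
  apply: (commut_svd tipP (T' := fun i => top (T' i))) => // j.
    exact: tens_op_linear.
  exact: tens_op_adjoint.
apply: bigmax_le => [|i _].
  rewrite lee_pdivlMl // mule0 /tuple_lorentz.
  elim/big_rec: _ => // i x _ x0.
  have [d [s [u [v Cs]]]] := comm_svd i.
  by rewrite le_max (lorentz_norm_ge0 p tipP Cs).
have [d [s [u [v Ds]]]] := commut_svd ipP T_lin T_adj i Ar.
have [d' [s' [u' [v' Cs]]]] := comm_svd i.
rewrite lee_pdivlMl //.
apply: le_trans (le_bigmax _ (fun i => lorentz_norm tip p
  (commut (fun i => top (T i)) B i)) i).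
rewrite (svd_lorentz_norm ipP p Ds) (svd_lorentz_norm tipP p Cs) -EFinM lee_fin.
apply: (lorentz_le_of_diag_blocks ipP m_gt0 p_ge1 Ds Cs) => x.
rewrite commut_average //; congr (_ *: _); apply: eq_bigr => k _.
exact: commut_diag_block.
Qed.

(** Take the projection onto the span of all components of vectors spanning the range of [B0]; its
    amplification is a projection fixing that range. *)
Lemma tens_op_cofinal B0 : R1plus tip B0 ->
  exists A0, R1plus ip A0 /\ op_le tip B0 (top A0).
Proof.
move=> B0r; have [_ [d [w Bw]] _] := B0r.
have tipP := tens_ip_inner_product ipP m.
have [e [f [fo fw]]] := gram_schmidt ipP [seq w i k | i <- enum 'I_d, k <- enum 'I_m].
exists (onproj ip e f); split; first exact: onproj_R1plus.
apply: (R1plus_le_idem tipP B0r).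
- by apply: tens_op_adjoint => x y; exact: (onproj_sym ipP).
- by move=> g; apply/ffunP => k; rewrite !ffunE (onproj_idem ipP).
move=> g; apply/ffunP => k; rewrite ffunE; have [b ->] := Bw g.
have ol := onproj_linear ipP e f.
rewrite sum_ffunE (linear_big ol); apply: eq_bigr => i _.
rewrite ffunE (linear_scale ol) fw //.
by apply/allpairsP; exists (i, k); rewrite !mem_enum.
Qed.

Lemma qc_modulus_tens_le :
  (qc_modulus tip p (fun i => top (T i)) <= c%:E * qc_modulus ip p T)%E.
Proof.
have tipP := tens_ip_inner_product ipP m.
apply: ge_ereal_sup => _ [B0 B0r <-].
have qc_ge0 : (0 <= qc_modulus ip p T)%E.
  apply: le_ereal_sup_tmp; eexists.
    by exists (fun=> 0); [exact: R1plus_zero|reflexivity].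
  apply: le_ereal_inf_tmp => _ [A [Ar _] <-]; rewrite /tuple_lorentz.
  elim/big_rec: _ => // i x _ x0.
  have [d [s [u [v Ds]]]] := commut_svd ipP T_lin T_adj i Ar.
  by rewrite le_max (lorentz_norm_ge0 p ipP Ds).
(* If the modulus is infinite, so is the right side, because the factor is positive. *)
case qcE : (qc_modulus ip p T) qc_ge0 => [r| |] // r_ge0; last first.
  by rewrite gt0_muley ?lte_fin // leey.
rewrite lee_fin in r_ge0.
have m_pos : 0 < m%:R :> R by rewrite ltr0n.
apply/lee_addgt0Pr => e e_gt0.
(* The error [e] is split in half: this slack becomes [e / 2] after multiplication by [c], and [eps]
   below becomes [e / 2] after multiplication by [m]. *)
pose alpha := r + e / 2 / c.
have e2c : 0 < e / 2 / c by rewrite !divr_gt0.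
have alpha_ge0 : 0 <= alpha by rewrite addr_ge0 // ltW.
have cofinal A0 : R1plus ip A0 -> exists A, [/\ R1plus ip A, op_le ip A0 A &
    (tuple_lorentz ip p (commut T A) <= alpha%:E)%E].
  move=> A0r; set S := [set tuple_lorentz ip p (commut T A) |
    A in [set A | R1plus ip A /\ op_le ip A0 A]]%classic.
  have : (ereal_inf S < alpha%:E)%E.
    apply: (@le_lt_trans _ _ r%:E); last by rewrite lte_fin ltrDl.
    by rewrite -qcE; apply: ereal_sup_ubound; exists A0.
  move=> /ereal_inf_lt[_ [A [Ar A0A] <-] lt1].
  by exists A; split=> //; exact: ltW.
have [A0 [A0r B0A0]] := tens_op_cofinal B0r.
pose eps := e / 2 / m%:R.
have eps_gt0 : 0 < eps by rewrite !divr_gt0.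
have [A [Ar A0A At A_small]] :=
  small_commutators ipP T_lin T_adj p_ge1 alpha_ge0 cofinal A0r T_bd eps_gt0.
apply: ge_ereal_inf; exists (tuple_lorentz tip p (commut (fun i => top (T i)) (top A))).
  exists (top A) => //; split; first exact: tens_op_R1plus.
  by apply: (op_le_trans B0A0); exact: tens_op_le.
apply: bigmax_le => [|i _].
  by rewrite -EFinM -EFinD lee_fin addr_ge0 ?mulr_ge0 // ltW.
have [d [s [u [v Ds]]]] := commut_svd ipP T_lin T_adj i Ar.
rewrite commut_tens_op (svd_lorentz_norm tipP p (svd_tens_op ipP m_gt0 Ds)).
rewrite -EFinM -EFinD lee_fin; have [_ s_dec _ _ _] := Ds.
apply: (le_trans (lorentz_tens_op_le m_gt0 d p_ge1 (svd_ge0 Ds) s_dec)).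
have s0_le : s 0%N <= eps.
  exact: (svd_top_le ipP Ds (ltW eps_gt0) (A_small i)).
have sum_le : \sum_(l < d) lorentz_weight p l * s l <= alpha.
  rewrite -lee_fin -(svd_lorentz_norm ipP p Ds); apply: le_trans At.
  exact: (le_bigmax _ (fun i => lorentz_norm ip p (commut T A i))).
apply: (@le_trans _ _ (c * alpha + m%:R * eps)).
  by rewrite lerD // ler_wpM2l // ltW.
rewrite le_eqVlt; apply/orP; left; apply/eqP.
by rewrite /alpha /eps; field; rewrite !gt_eqF.
Qed.

End TensorModulus.

Theorem theorem3p1 (R : realType) (V : lmodType R[i]) (ip : V -> V -> R[i])
  (hH : separable_inf_hilbert ip)
  (n : nat) (T : 'I_n -> V -> V)
  (hlin : forall i, linear (T i)) (hbd : forall i, bounded_op ip (T i))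
  (p : \bar R) (hp : (1 <= p)%E) (m : nat) (hm : (0 < m)%N) :
  qc_modulus (tens_ip ip (m:=m)) p (fun i => tens_op (T i)) =
  ((powR m%:R (invp p))%:E * qc_modulus ip p T)%E.
Proof.
have [ipP ipc _ _] := hH.
have /choice[T' T_adj] i := adjoint_exists ipP ipc (hlin i) (hbd i).
have /choice[M T_bd] := hbd.
have T_bd2 i := bounded_op_sqnorm ipP (T_bd i).
apply/eqP; rewrite eq_le.
by rewrite (qc_modulus_tens_le ipP hlin T_adj T_bd2 hp hm)
  (qc_modulus_tens_ge ipP hlin T_adj hp hm).
Qed.
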